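(* Let $\mathbb{F}$ be a field of characteristic different from $2$, let $V$ be an $n$-dimensional vector space over $\mathbb{F}$, and let $b$ be a non-degenerate alternating bilinear form on $V$ with Witt index $\nu$ (so $\nu=n/2$). Let $\mathcal{V}$ be a linear subspace of $\mathcal{A}_b$ consisting only of nilpotent endomorphisms, with $\dim\mathcal{V}=\nu(n-\nu-1)$. Then there exists a maximal partially complete $b$-singular flag $\mathcal{F}$ of $V$ such that $\mathcal{V}=\mathrm{WA}_{b,\mathcal{F}}$.
   Context: The Witt index of $b$ is the maximal dimension of a linear subspace $X\subseteq V$ that is totally singular, i.e. $b(x,y)=0$ for all $x,y\in X$. An endomorphism $u$ of $V$ is $b$-alternating if $(x,y)\mapsto b(x,u(y))$ is an alternating bilinear form (vanishes on all $(x,x)$); $\mathcal{A}_b$ is the space of $b$-alternating endomorphisms. A flag of $V$ is an increasing sequence $\mathcal{F}=(F_0,\dots,F_p)$ of linear subspaces; it is partially complete if $\dim F_i=i$ for all $i$; it is $b$-singular if $F_p$ is totally singular for $b$; a partially complete $b$-singular flag is maximal if $p$ equals the Witt index of $b$. An endomorphism $u$ stabilizes $\mathcal{F}$ if $u(F_i)\subseteq F_i$ for all $i$. $\mathrm{WA}_{b,\mathcal{F}}$ denotes the set of all nilpotent $u\in\mathcal{A}_b$ that stabilize $\mathcal{F}$. *)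

(* Defs.v *)
(* V = 'rV[F]_n (row vectors), endomorphisms = 'M[F]_n acting
   on the right: u(x) := x *m u. Subspaces of V are row spaces of matrices;
   subspaces of End(V) are row spaces of matrices 'M_(k, n*n) via mxvec. *)
From HB Require Import structures.
From mathcomp Require Import all_boot all_order all_algebra.
Set Implicit Arguments. Unset Strict Implicit. Unset Printing Implicit Defensive.
Import GRing.Theory.
Local Open Scope ring_scope.

Section Defs.
Variables (F : fieldType) (n : nat).

Definition bform (B : 'M[F]_n) (x y : 'rV[F]_n) : F := (x *m B *m y^T) 0 0.

Definition alternating_form (B : 'M[F]_n) : Prop :=
  forall x : 'rV[F]_n, bform B x x = 0.

Definition nondegenerate_form (B : 'M[F]_n) : Prop :=
  forall x : 'rV[F]_n, (forall y, bform B x y = 0) -> x = 0.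

Definition totally_singular (B : 'M[F]_n) (m : nat) (X : 'M[F]_(m, n)) : Prop :=
  forall x y : 'rV[F]_n, (x <= X)%MS -> (y <= X)%MS -> bform B x y = 0.

Definition witt_index (B : 'M[F]_n) (nu : nat) : Prop :=
  (exists X : 'M[F]_n, totally_singular B X /\ \rank X = nu) /\
  (forall X : 'M[F]_n, totally_singular B X -> (\rank X <= nu)%N).

Definition b_alternating (B : 'M[F]_n) (u : 'M[F]_n) : Prop :=
  forall x : 'rV[F]_n, bform B x (x *m u) = 0.

Definition nilpotent_mx (u : 'M[F]_n) : Prop := exists k : nat, u ^+ k = 0.

(* A flag (F_0, ..., F_p), given as a nat-indexed family of subspaces
   (only the indices 0..p matter), partially complete and b-singular. *)
Definition partially_complete_flag (p : nat) (Fl : nat -> 'M[F]_n) : Prop :=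
  (forall i, (i < p)%N -> (Fl i <= Fl i.+1)%MS) /\
  (forall i, (i <= p)%N -> \rank (Fl i) = i).

Definition b_singular_flag (B : 'M[F]_n) (p : nat) (Fl : nat -> 'M[F]_n) : Prop :=
  totally_singular B (Fl p).

Definition maximal_singular_flag (B : 'M[F]_n) (p : nat) (Fl : nat -> 'M[F]_n) : Prop :=
  partially_complete_flag p Fl /\ b_singular_flag B p Fl /\ witt_index B p.

Definition stabilizes (p : nat) (Fl : nat -> 'M[F]_n) (u : 'M[F]_n) : Prop :=
  forall i, (i <= p)%N -> (Fl i *m u <= Fl i)%MS.

Definition in_WA (B : 'M[F]_n) (p : nat) (Fl : nat -> 'M[F]_n) (u : 'M[F]_n) : Prop :=
  nilpotent_mx u /\ b_alternating B u /\ stabilizes p Fl u.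

End Defs.

(* Main.v *)
Require Import Defs.
From HB Require Import structures.
From mathcomp Require Import all_boot all_order all_algebra.
From mathcomp Require Import ring zify.
Import GRing.Theory.
Local Open Scope ring_scope.

(* Write x /\ y for the endomorphism t |-> b(x,t) y - b(y,t) x; these span the
   b-alternating (equivalently, b-selfadjoint) endomorphisms, and
   tr ((x /\ y) v) = 2 b(x, y v). Nilpotency makes the space S totally isotropic for
   the trace form. For x <> 0, reduce S to the nondegenerate space x^perp / x: the
   elements of S killing x act there nilpotently, and the kernel of this reduction
   consists of the x /\ w in S, whose w are orthogonal to x and to x S. Counting
   dimensions gives dim S <= nu (nu - 1) by induction. In the extremal case the
   reduction is extremal for every x, and x /\ w is in S as soon as w is orthogonal
   to x and to x S.

   It then suffices to find a nonzero x with x S = 0; the flag follows by induction.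
   If x S <> 0, a rank-one perturbation argument shows that x S + <x> contains all
   x v^k (v in S), hence x S is stable under the reduction, and by induction it
   contains some y = x v killed by the reduction. The identity tr (u^2 v) = 0, valid on
   S in every characteristic other than 2, forces y to be killed by every u in S that
   kills x. Then v stabilizes <x, y>, so it kills some nonzero z there, and
   dim (z S) < dim (x S). *)

Set Implicit Arguments. Unset Strict Implicit. Unset Printing Implicit Defensive.

(** * Nilpotent matrices *)

Section NilpotentMatrices.
Variable F : fieldType.
Implicit Types (n : nat).

Local Notation polymx := (map_mx (@polyC F)).

Lemma polymxX n (u : 'M[F]_n) k : polymx (u ^+ k) = polymx u ^+ k.
Proof.
elim: k => [|k IHk]; first by rewrite !expr0 map_mx1.
by rewrite !exprS map_mxM IHk.
Qed.

Lemma mulmx_exprSr n (u : 'M[F]_n) k : u ^+ k *m u = u ^+ k.+1.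
Proof. by rewrite exprSr. Qed.

Lemma mulmx_exprS n (u : 'M[F]_n) k : u *m u ^+ k = u ^+ k.+1.
Proof. by rewrite exprS. Qed.

Lemma exprmx_ge n (u : 'M[F]_n) k m : u ^+ k = 0 -> (k <= m)%N -> u ^+ m = 0.
Proof. by move=> uk0 /subnK <-; rewrite exprD uk0 mulr0. Qed.

(** When [u ^+ k = 0], the factor ['X - u] of ['X^k - u ^+ k] makes [char_poly u] divide a power of
    ['X]; it is monic of degree [n]. *)
Lemma char_poly_nilpotent n (u : 'M[F]_n) :
  nilpotent_mx u -> char_poly u = 'X^n.
Proof.
case=> k uk0.
have cXu : GRing.comm ('X%:M : 'M[{poly F}]_n) (polymx u).
  by rewrite /GRing.comm; apply: esym; apply: scalar_mxC.
have := subrXX_comm k cXu; rewrite -polymxX uk0 map_mx0 subr0.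
rewrite -[X in X * _]/(char_poly_mx u) => /(congr1 determinant).
rewrite det_mulmx -/(char_poly u) => def_X.
have : (char_poly u %| ('X - 0%:P) ^+ (k * n))%R.
  rewrite subr0; apply/dvdpP.
  exists (\det (\sum_(i < k) 'X%:M ^+ (k.-1 - i) * (polymx u) ^+ i)).
  rewrite mulrC -def_X.
  suff -> : ('X%:M : 'M[{poly F}]_n) ^+ k = ('X^k)%:M by rewrite det_scalar exprM.
  elim: k {uk0 cXu def_X} => [|k IHk]; first by rewrite !expr0.
  by rewrite !exprS IHk -mulmxE -scalar_mxM.
case/dvdp_exp_XsubCP => m _; rewrite subr0 => /eqpP[[a b]] /= /andP[a0 b0] eq_ab.
have em : char_poly u = (a^-1 * b) *: 'X^m.
  by rewrite -scalerA -eq_ab scalerA mulVf // scale1r.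
have := char_poly_monic u; rewrite em monicE lead_coefZ lead_coefXn mulr1.
move/eqP => ab1; move: em; rewrite ab1 scale1r => em.
have := size_char_poly u; rewrite em size_polyXn => -[em2].
by rewrite em2.
Qed.

Lemma mxtrace_nilpotent n (u : 'M[F]_n) : nilpotent_mx u -> \tr u = 0.
Proof.
case: n u => [|n] u nil_u; first by rewrite /mxtrace big_ord0.
have := char_poly_trace u (ltn0Sn n); rewrite char_poly_nilpotent //= coefXn.
by rewrite (ltn_eqF (ltnSn n)) => /eqP; rewrite eq_sym oppr_eq0 => /eqP.
Qed.

(** The truncated geometric series for the inverse of [1 - 'X u], exact once [u ^+ k = 0]. *)
Definition resolvent n (u : 'M[F]_n) k : 'M[{poly F}]_n :=
  \sum_(i < k) 'X^i *: polymx (u ^+ i).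

Lemma mul_resolvent n (u : 'M[F]_n) k : u ^+ k = 0 ->
  (1%:M - 'X *: polymx u) *m resolvent u k = 1%:M.
Proof.
move=> uk0; suff -> : forall m, (1%:M - 'X *: polymx u) *m resolvent u m =
    1%:M - 'X^m *: polymx (u ^+ m) by rewrite uk0 map_mx0 scaler0 subr0.
elim=> [|m IHm].
  by rewrite /resolvent big_ord0 mulmx0 !expr0 map_mx1 scale1r subrr.
rewrite /resolvent big_ord_recr /= mulmxDr IHm mulmxBl mul1mx -scalemxAl.
by rewrite -scalemxAr scalerA -exprS -map_mxM mulmxE -exprS addrA subrK.
Qed.

(** The resolvent makes this determinant a unit of F[X], hence a constant, which is read off at
    ['X = 0]. *)
Lemma det_one_sub_nilpotent n (u : 'M[F]_n) :
  nilpotent_mx u -> \det (1%:M - 'X *: polymx u) = 1.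
Proof.
case=> k uk0; have /(congr1 determinant) := mul_resolvent uk0.
rewrite det_mulmx det1; set d := \det (1%:M - _) => d_inv.
have : d \is a GRing.unit by apply/unitrPr; eexists; exact: d_inv.
rewrite poly_unitE => /andP[/size_poly1P[c c0 def_d] _].
rewrite def_d; congr polyC.
have <- : d.[0] = c by rewrite def_d hornerC.
rewrite -[d.[0]]/(horner_eval 0 d) /d -det_map_mx map_mxB map_mx1 map_mxZ /=.
by rewrite /horner_eval hornerX scale0r subr0 det1.
Qed.

Lemma horner_char_poly (R : comNzRingType) n (A : 'M[R]_n) a :
  (char_poly A).[a] = \det (a%:M - A).
Proof.
rewrite -[LHS]/(horner_eval a _) /char_poly -det_map_mx; congr determinant.
apply/matrixP => i j; rewrite !mxE /= /horner_eval hornerD hornerN hornerC.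
by rewrite hornerMn hornerX.
Qed.

Lemma coef_char_polyZ (R : idomainType) n (A : 'M[R]_n) s i :
  s != 0 -> (i <= n)%N ->
  (char_poly (s *: A))`_i = s ^+ (n - i) * (char_poly A)`_i.
Proof.
move=> s0 le_in.
have: char_poly (s *: A) \Po (s *: 'X) = s%:P ^+ n * char_poly A.
  rewrite -detZ -[LHS]/(comp_poly (s *: 'X) _) -det_map_mx; congr determinant.
  apply/matrixP=> j k; rewrite !mxE /= comp_polyB comp_polyC.
  by rewrite rmorphMn /= comp_polyX mulrBr mulrnAr mul_polyC -polyCM.
move/(congr1 (fun p : {poly R} => p`_i)); rewrite -polyC_exp coefCM.
rewrite coef_comp_poly size_char_poly (bigD1 (inord i)) //= inordK ?ltnS //.
rewrite exprZn coefZ coefXn eqxx mulr1 big1 ?addr0 => [|j ne_ji]; last first.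
  rewrite exprZn coefZ coefXn; case: eqP => [eij|]; last by rewrite !mulr0.
  by case/eqP: ne_ji; apply/val_inj; rewrite /= inordK // ltnS.
rewrite mulrC => eq_s; apply: (mulfI (expf_neq0 i s0)).
by rewrite mulrA -exprD subnKC.
Qed.

Lemma det_one_sub_expand (R : idomainType) n (A : 'M[R]_n) s : s != 0 ->
  \det (1%:M - s *: A) = \sum_(i < n.+1) s ^+ (n - i) * (char_poly A)`_i.
Proof.
move=> s0; rewrite -horner_char_poly horner_coef size_char_poly.
apply: eq_bigr => i _.
by rewrite expr1n mulr1 (coef_char_polyZ _ s0) // -ltnS.
Qed.

(* With [Z := (1 - s u)^-1 v] over F[s], the hypotheses on [u + v] and [u - v]
   say [det (1 - s Z) = det (1 + s Z) = 1]. In the difference, only the trace of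
   [Z] and the third coefficient of [char_poly v = 'X^n] contribute to [s ^ 3]. *)
Lemma mxtrace_sqrM_nilpotent n (u v : 'M[F]_n) : (2%:R : F) != 0 ->
  nilpotent_mx u -> nilpotent_mx v ->
  nilpotent_mx (u + v) -> nilpotent_mx (u - v) ->
  \tr (u *m u *m v) = 0.
Proof.
move=> two0 nil_u nil_v nil_uDv nil_uBv.
case: n => [|n] in u v nil_u nil_v nil_uDv nil_uBv *.
  by rewrite /mxtrace big_ord0.
(* The extra 3 guarantees that the truncated series contains the term in [u ^+ 2], even for small
   [k]. *)
have [k uk0] := nil_u; have uk3 : u ^+ (k + 3) = 0 by rewrite exprD uk0 mul0r.
pose Z := resolvent u (k + 3) *m polymx v.
have detZ (c : {poly F}) (w : 'M[F]_n.+1) : nilpotent_mx w ->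
    (1%:M - 'X *: polymx u) - c *: polymx v = 1%:M - 'X *: polymx w ->
    \det (1%:M - c *: Z) = 1.
  move=> nil_w def_w.
  have -> : \det (1%:M - c *: Z) =
     \det ((1%:M - 'X *: polymx u) *m (1%:M - c *: Z)).
    by rewrite det_mulmx det_one_sub_nilpotent ?mul1r.
  by rewrite mulmxBr mulmx1 -scalemxAr mulmxA mul_resolvent // mul1mx def_w
    det_one_sub_nilpotent.
have detD : \det (1%:M - 'X *: Z) = 1.
  by apply: (detZ _ _ nil_uDv); rewrite map_mxD scalerDr opprD addrA.
have detB : \det (1%:M - (- 'X) *: Z) = 1.
  apply: (detZ _ _ nil_uBv).
  by rewrite map_mxB scalerBr scaleNr opprK opprB addrA addrAC.
have X0 : ('X : {poly F}) != 0 by rewrite polyX_eq0.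
move: detD detB; rewrite !det_one_sub_expand ?oppr_eq0 // => <- /(congr1 (fun p : {poly F} => p`_3)).
rewrite !coef_sum => /eqP; rewrite -subr_eq0 -sumrB.
have lt_n : (n < n.+2)%N by [].
have z0 i : (char_poly Z)`_i`_0 = (i == n.+1)%:R.
  rewrite -horner_coef0 -[_.[0]]/(horner_eval 0 _) -coef_map map_char_poly.
  suff -> : map_mx (horner_eval 0) Z = v by rewrite char_poly_nilpotent // coefXn.
  rewrite map_mxM addnS /resolvent big_ord_recl expr0 expr0 scale1r map_mx1.
  rewrite map_mxD map_mx1 mulmxDl mul1mx -[RHS]addr0; congr (_ + _).
    by apply/matrixP => a c; rewrite !mxE /= /horner_eval hornerC.
  rewrite -[RHS](mul0mx _ (map_mx (horner_eval 0) (polymx v))).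
  congr mulmx; apply/matrixP => a c; rewrite !mxE /= /horner_eval summxE horner_sum.
  by rewrite big1 // => l _; rewrite mxE hornerM hornerXn exprS !mul0r.
have zn : (char_poly Z)`_n`_2 = - \tr (u *m u *m v).
  have -> : (char_poly Z)`_n = - \tr Z by exact: (char_poly_trace Z (ltn0Sn n)).
  rewrite coefN; congr (- _).
  rewrite /Z /resolvent mulmx_suml raddf_sum coef_sum addnS.
  have lt2 : (2 < (k + 2).+1)%N by rewrite ltnS leq_addl.
  rewrite (bigD1 (Ordinal lt2)) //= big1 => [|i ne_i2].
    rewrite addr0 -scalemxAl mxtraceZ coefXnM /= -map_mxM.
    by rewrite trace_map_mx coefC /= expr2.
  rewrite -scalemxAl mxtraceZ coefXnM -map_mxM trace_map_mx coefC.
  case: ltnP => // le_i2; case: eqP => // /eqP; rewrite subn_eq0 => le_2i.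
  by case/eqP: ne_i2; apply/val_inj/eqP; rewrite eqn_leq le_i2 le_2i.
rewrite (bigD1 (Ordinal lt_n)) //= big1 => [|i ne_in].
  rewrite subSnn !expr1 addr0 mulNr coefN coefXM /= zn opprK.
  rewrite -mulr2n -mulr_natl mulf_eq0 (negPf two0) /=.
  by move/eqP.
(* [j] is the power of [s] carried by the term. Even powers cancel in the difference, powers above 3
   do not reach [s ^ 3], and for [j = 3] only the constant coefficient given by [z0] counts, which
   is zero. *)
have [j def_j] : exists j, j = (n.+1 - i)%N by eexists.
rewrite -def_j exprNn -signr_odd; case odd_j : (odd j); last first.
  by rewrite expr0 mul1r subrr.
rewrite expr1 mulN1r mulNr coefN -opprD coefXnM.
case: ltnP => [|le_j3]; first by rewrite addr0 oppr0.
have j3 : j = 3%N.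
  case: j def_j odd_j le_j3 => [|[|[|[|j]]]] // def_j _ _.
  case/eqP: ne_in; apply/val_inj; rewrite /=.
  by have := ltn_ord i; move: def_j; lia.
rewrite j3 subnn z0 ltn_eqF ?addr0 ?oppr0 //; lia.
Qed.

(* If [th j] is the last nonzero scalar such that [x v^j (e - v) = th j x], then
   telescoping [x e^r] and multiplying by a power of [e] leaves only [th j x e^r']. *)
Lemma order_lt_of_rank_one_diff n (v e K : 'M[F]_n) (x : 'rV[F]_n) r r' j :
  (x <= K)%MS -> (K *m v <= K)%MS -> (K *m (e - v) <= x)%MS ->
  x *m v ^+ r = 0 -> x *m e ^+ r'.+1 = 0 -> x *m e ^+ r' != 0 ->
  x *m v ^+ j *m (e - v) != 0 -> (r'.+1 < r)%N.
Proof.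
move=> xK vK dK xvr xer' xer'N nz_j.
pose th i := (x *m v ^+ i *m (e - v) *m pinvmx x) 0 0.
have xvK i : (x *m v ^+ i <= K)%MS.
  elim: i => [|i IHi]; first by rewrite expr0 mulmx1.
  by rewrite exprSr -mulmxE mulmxA (submx_trans (submxMr _ IHi)).
have thE i : x *m v ^+ i *m (e - v) = th i *: x.
  have dx : (x *m v ^+ i *m (e - v) <= x)%MS.
    exact: submx_trans (submxMr _ (xvK i)) dK.
  by rewrite -[LHS](mulmxKpV dx) [_ *m pinvmx x]mx11_scalar mul_scalar_mx.
have xvge i : (r <= i)%N -> x *m v ^+ i = 0.
  by move=> /subnKC <-; rewrite exprD -mulmxE mulmxA xvr mul0mx.
have xege i : (r' < i)%N -> x *m e ^+ i = 0.
  by move=> /subnKC <-; rewrite exprD -mulmxE mulmxA xer' mul0mx.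
have x0 : x != 0 by apply: contraNneq xer'N => ->; rewrite mul0mx.
have telescope m :
    x *m e ^+ m = x *m v ^+ m + \sum_(i < m) th i *: (x *m e ^+ (m.-1 - i)).
  elim: m => [|m IHm]; first by rewrite big_ord0 addr0.
  rewrite exprSr -mulmxE mulmxA IHm mulmxDl big_ord_recr /= subnn expr0 mulmx1.
  rewrite -thE mulmxBr -[x *m v ^+ m *m v]mulmxA mulmx_exprSr.
  rewrite addrCA [_ + (_ - _)]addrC subrK addrC; congr (_ + _).
  rewrite mulmx_suml; apply: eq_bigr => i _.
  rewrite -scalemxAl -mulmxA mulmx_exprSr; congr (_ *: (_ *m _ ^+ _)).
  by have := ltn_ord i; lia.
have th_max i : th i != 0 -> (i <= r)%N.
  move=> thi; rewrite leqNgt; apply: contra thi => lt_ri.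
  have := thE i; rewrite xvge ?mul0mx ?(ltnW lt_ri) // => /esym/eqP.
  by rewrite scaler_eq0 (negPf x0) orbF.
have exJ : exists i, th i != 0.
  by exists j; apply: contra nz_j => /eqP th0; rewrite thE th0 scale0r.
case: (ex_maxnP exJ th_max) => J thJ max_J.
have lt_Jr : (J < r)%N.
  rewrite ltnNge; apply: contra thJ => le_rJ; have := thE J.
  by rewrite xvge // mul0mx => /esym/eqP; rewrite scaler_eq0 (negPf x0) orbF.
rewrite ltnNge; apply/negP => le_r.
have /(congr1 (fun t => t *m e ^+ (r'.+1 + J - r))) := telescope r.
rewrite -mulmxA mulmxE -exprD xege; last by lia.
rewrite xvr add0r mulmx_suml (bigD1 (Ordinal lt_Jr)) //= big1 => [|i ne_iJ].
  rewrite addr0 -scalemxAl -mulmxA mulmxE -exprD.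
  have -> : (r.-1 - J + (r'.+1 + J - r) = r')%N by lia.
  by move/esym/eqP; rewrite scaler_eq0 (negPf thJ) (negPf xer'N).
have [thi0|/max_J le_iJ] := eqVneq (th i) 0; first by rewrite thi0 scale0r mul0mx.
rewrite -scalemxAl -mulmxA mulmxE -exprD xege ?scaler0 //.
have : (i : nat) != J by apply: contraNneq ne_iJ => eiJ; apply/eqP/val_inj.
by have := ltn_ord i; lia.
Qed.

(** The order comparison applies in both directions, to [v] and to [e := v + d]. If [d] is nonzero
    on the [v]-orbit of [x], then [e] has the smaller order on [x], so [d] vanishes on the
    [e]-orbit; the two orbits then coincide, a contradiction. *)
Lemma rank_one_perturbation n (v d K : 'M[F]_n) (x : 'rV[F]_n) j :
  nilpotent_mx v -> nilpotent_mx (v + d) ->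
  (x <= K)%MS -> (K *m v <= K)%MS -> (K *m d <= x)%MS ->
  x *m v ^+ j *m d = 0.
Proof.
move=> [a va0] [c ec0] xK vK dK; set e := v + d in ec0.
have de : e - v = d by rewrite /e addrC addKr.
have ed : v - e = - d by rewrite -opprB de.
have eK : (K *m e <= K)%MS.
  by rewrite mulmxDr addmx_sub // (submx_trans dK).
have [->|x0] := eqVneq x 0; first by rewrite !mul0mx.
have order (w : 'M[F]_n) k : w ^+ k = 0 ->
    exists r, x *m w ^+ r.+1 = 0 /\ x *m w ^+ r != 0.
  move=> wk0; have ex0 : exists k, x *m w ^+ k == 0 by exists k; rewrite wk0 mulmx0.
  case: (ex_minnP ex0) => -[|r] /eqP xr0 min_r.
    by case/eqP: x0; rewrite -xr0 expr0 mulmx1.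
  by exists r; split=> //; apply/negP => /min_r; rewrite ltnn.
have [r [xvr xvrN]] := order v a va0; have [r' [xer xerN]] := order e c ec0.
apply/eqP; apply/negPn/negP => nz_j.
have lt_r'r : (r'.+1 < r.+1)%N.
  by apply: (@order_lt_of_rank_one_diff _ v e K x _ _ j); rewrite ?de.
have : forall i, x *m e ^+ i *m d = 0.
  move=> i; apply/eqP; apply/negPn/negP => nz_i.
  have : (r.+1 < r'.+1)%N.
    apply: (@order_lt_of_rank_one_diff _ e v K x _ _ i); rewrite ?ed //.
      by rewrite mulmxN eqmx_opp.
    by rewrite mulmxN oppr_eq0.
  by rewrite ltnNge (ltnW lt_r'r).
move=> xed0; suff xev : forall i, x *m e ^+ i = x *m v ^+ i.
  by move: nz_j; rewrite -xev xed0 eqxx.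
elim=> [|i IHi]; first by rewrite !expr0.
rewrite !exprSr -!mulmxE !mulmxA -IHi; apply/eqP.
by rewrite -subr_eq0 -mulmxBr de xed0.
Qed.

Lemma rank_one_perturbation_cyclic n (v d : 'M[F]_n) (x : 'rV[F]_n) j :
  nilpotent_mx v -> nilpotent_mx (v + d) ->
  (forall i, (x *m v ^+ i *m d <= x)%MS) -> x *m v ^+ j *m d = 0.
Proof.
move=> nil_v nil_vd vd; have [k vk0] := nil_v.
pose K := (\sum_(i < k.+1) <<x *m v ^+ i>>)%MS.
apply: (@rank_one_perturbation _ v d K x j) => //.
- by apply: (sumsmx_sup ord0) => //; rewrite genmxE expr0 mulmx1.
- rewrite sumsmxMr; apply/sumsmx_subP => i _.
  rewrite (eqmxMr _ (genmxE _)) -mulmxA mulmx_exprSr.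
  have [lt_ik|le_ki] := ltnP i k; last first.
    by rewrite (exprmx_ge vk0) ?mulmx0 ?sub0mx // leqW.
  by apply: (sumsmx_sup (Ordinal (lt_ik : i.+1 < k.+1)%N)) => //; rewrite genmxE.
- rewrite sumsmxMr; apply/sumsmx_subP => i _.
  by rewrite (eqmxMr _ (genmxE _)).
Qed.

End NilpotentMatrices.

Lemma mulmx_ext (F : fieldType) n (u v : 'M[F]_n) :
  (forall t : 'rV_n, t *m u = t *m v) -> u = v.
Proof. by move=> uv; apply/row_matrixP => i; rewrite !rowE. Qed.

(** * Symplectic forms and selfadjoint endomorphisms *)

Section Symplectic.
Variables (F : fieldType) (n : nat) (B : 'M[F]_n).
Hypothesis hchar : (2%:R : F) != 0.
Hypothesis halt : alternating_form B.
Hypothesis hnd : nondegenerate_form B.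

Local Notation b := (bform B).
Implicit Types (x y z w t a c e f g : 'rV[F]_n) (u v : 'M[F]_n).

Lemma bformDl x y z : b (x + y) z = b x z + b y z.
Proof. by rewrite /bform !mulmxDl mxE. Qed.
Lemma bformDr x y z : b x (y + z) = b x y + b x z.
Proof. by rewrite /bform linearD /= mulmxDr mxE. Qed.
Lemma bformZl k x y : b (k *: x) y = k * b x y.
Proof. by rewrite /bform -!scalemxAl mxE. Qed.
Lemma bformZr k x y : b x (k *: y) = k * b x y.
Proof. by rewrite /bform linearZ /= -scalemxAr mxE. Qed.
Lemma bform0l x : b 0 x = 0.
Proof. by rewrite /bform !mul0mx mxE. Qed.
Lemma bform0r x : b x 0 = 0.
Proof. by rewrite /bform trmx0 mulmx0 mxE. Qed.
Lemma bformNl x y : b (- x) y = - b x y.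
Proof. by rewrite -scaleN1r bformZl mulN1r. Qed.
Lemma bformNr x y : b x (- y) = - b x y.
Proof. by rewrite -scaleN1r bformZr mulN1r. Qed.
Definition bformE := (bformDl, bformDr, bformZl, bformZr, bformNl, bformNr,
  bform0l, bform0r).

Lemma bform_antisym x y : b x y = - b y x.
Proof.
have := halt (x + y); rewrite !bformE !halt add0r addr0 => /eqP.
by rewrite addr_eq0 => /eqP.
Qed.

Lemma bform_eq0C x y : b x y = 0 -> b y x = 0.
Proof. by move=> xy0; rewrite bform_antisym xy0 oppr0. Qed.

Lemma eq_opp_eq0 (k : F) : k = - k -> k = 0.
Proof.
move/eqP; rewrite -addr_eq0 -mulr2n -mulr_natl mulf_eq0 (negPf hchar).
by move/eqP.
Qed.

Lemma form_unitmx : B \in unitmx.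
Proof.
rewrite -row_free_unit; apply: inj_row_free => x xB0.
by apply: hnd => y; rewrite /bform xB0 mul0mx mxE.
Qed.

(** A nonvanishing coordinate of [t] modulo [X] is a linear form killing [X]; nondegeneracy
    represents it by some [w]. *)
Lemma bform_separate m (X : 'M[F]_(m, n)) t : ~~ (t <= X)%MS ->
  exists w, (forall z, (z <= X)%MS -> b w z = 0) /\ b w t = 1.
Proof.
rewrite submxE => /eqP tX.
have [j tXj] : exists j, (t *m cokermx X) 0 j != 0.
  apply/existsP; apply: contra_notT tX => /existsPn tX.
  by apply/rowP => j; rewrite [RHS]mxE; apply/eqP; rewrite -[_ == _]negbK.
pose k := (t *m cokermx X) 0 j.
pose w := k^-1 *: ((col j (cokermx X))^T *m invmx B).
have wE z : b w z = k^-1 * (z *m cokermx X) 0 j.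
  rewrite /w bformZl; congr (_ * _).
  rewrite /bform mulmxKV ?form_unitmx // -trmx_mul mxE colE mulmxA -colE.
  by rewrite mxE.
exists w; split=> [z /submxP[D ->]|]; last by rewrite wE mulVf.
by rewrite wE -mulmxA mulmx_coker mulmx0 mxE mulr0.
Qed.

Definition selfadjoint u := forall x y, b (x *m u) y = b x (y *m u).

Lemma alternating_selfadjoint u : b_alternating B u -> selfadjoint u.
Proof.
move=> alt_u x y; have := alt_u (x + y).
rewrite mulmxDl !bformE !alt_u add0r addr0 => /eqP; rewrite addr_eq0 => /eqP ->.
by rewrite -bform_antisym.
Qed.

Lemma selfadjoint_alternating u : selfadjoint u -> b_alternating B u.
Proof.
by move=> sa_u x; apply: eq_opp_eq0; rewrite -bform_antisym sa_u.
Qed.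

Lemma selfadjointD u v : selfadjoint u -> selfadjoint v -> selfadjoint (u + v).
Proof. by move=> su sv x y; rewrite !mulmxDr !bformE su sv. Qed.
Lemma selfadjointN u : selfadjoint u -> selfadjoint (- u).
Proof. by move=> su x y; rewrite !mulmxN !bformE su. Qed.
Lemma selfadjoint_conj u v :
  selfadjoint u -> selfadjoint v -> selfadjoint (u *m v *m u).
Proof. by move=> su sv x y; rewrite !mulmxA su sv su. Qed.
Lemma selfadjoint_exp u k : selfadjoint u -> selfadjoint (u ^+ k).
Proof.
move=> su; elim: k => [|k IHk] x y; first by rewrite expr0 !mulmx1.
by rewrite {1}exprS exprSr -!mulmxE !mulmxA IHk su.
Qed.

Definition wedge x y : 'M[F]_n := B^T *m x^T *m y - B^T *m y^T *m x.

Lemma mul_wedge t x y : t *m wedge x y = b x t *: y - b y t *: x.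
Proof.
have tE x' y' : t *m (B^T *m x'^T *m y') = b x' t *: y'.
  have tBx : t *m B^T *m x'^T = (x' *m B *m t^T)^T.
    by rewrite !trmx_mul trmxK mulmxA.
  by rewrite !mulmxA tBx [_^T]mx11_scalar mul_scalar_mx mxE.
by rewrite mulmxBr !tE.
Qed.

Lemma wedge_selfadjoint x y : selfadjoint (wedge x y).
Proof.
move=> s t; rewrite !mul_wedge !bformE [b s y]bform_antisym [b s x]bform_antisym.
ring.
Qed.

Lemma wedgexx x : wedge x x = 0.
Proof. by rewrite /wedge subrr. Qed.
Lemma wedgeC x y : wedge x y = - wedge y x.
Proof. by rewrite /wedge opprB. Qed.
Lemma wedgeDl x y z : wedge (x + y) z = wedge x z + wedge y z.
Proof. by rewrite /wedge linearD /= !mulmxDr mulmxDl opprD addrACA. Qed.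
Lemma wedgeZl k x y : wedge (k *: x) y = k *: wedge x y.
Proof.
by rewrite /wedge linearZ /= -!scalemxAr -scalemxAl scalerBr.
Qed.
Lemma wedgeDr x y z : wedge x (y + z) = wedge x y + wedge x z.
Proof. by rewrite wedgeC wedgeDl opprD -!(wedgeC x). Qed.
Lemma wedgeZr k x y : wedge x (k *: y) = k *: wedge x y.
Proof. by rewrite wedgeC wedgeZl -scalerN -wedgeC. Qed.
Lemma wedge0r x : wedge x 0 = 0.
Proof. by rewrite -(scale0r (0 : 'rV_n)) wedgeZr scale0r. Qed.

Lemma mxtrace_wedge x y v : selfadjoint v ->
  \tr (wedge x y *m v) = 2%:R * b x (y *m v).
Proof.
move=> sv; have trE x' y' : \tr (B^T *m x'^T *m y' *m v) = b x' (y' *m v).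
  rewrite -mulmxA mxtrace_mulC mulmxA trace_mx11 /bform.
  have -> : y' *m v *m B^T *m x'^T = (x' *m B *m (y' *m v)^T)^T.
    by rewrite !trmx_mul !trmxK !mulmxA.
  by rewrite mxE.
by rewrite mulmxBl raddfB /= !trE -sv [b (x *m v) y]bform_antisym; ring.
Qed.

Lemma wedge_square x y : b x y = 0 -> wedge x y *m wedge x y = 0.
Proof.
move=> bxy; apply: mulmx_ext => t; rewrite mulmxA (mul_wedge t) mulmxBl -!scalemxAl.
by rewrite !mul_wedge !halt bxy (bform_eq0C bxy) !scale0r !subr0 !scaler0 subr0 mulmx0.
Qed.

(** A nonzero [x] is an eigenvector of [wedge x y], with eigenvalue [b x y]. *)
Lemma wedge_nilpotent_orth x y : nilpotent_mx (wedge x y) -> b x y = 0.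
Proof.
have [-> _|x0 [k wk0]] := eqVneq x 0; first by rewrite bform0l.
have : forall j, x *m wedge x y ^+ j = (b x y) ^+ j *: x.
  elim=> [|j IHj]; first by rewrite !expr0 mulmx1 scale1r.
  rewrite exprS -mulmxE mulmxA mul_wedge halt scale0r add0r -scaleNr.
  by rewrite -bform_antisym -scalemxAl IHj scalerA -exprS.
move/(_ k)/eqP; rewrite wk0 mulmx0 eq_sym scaler_eq0 (negPf x0) orbF.
by rewrite expf_eq0 => /andP[_ /eqP].
Qed.

(** Since [pi] is selfadjoint and fixes [D], the pairing with [D] factors through [pi], so it keeps
    its full rank [\rank D] on the image of [pi]. *)
Lemma selfadjoint_orth_rank r (D : 'M[F]_(r, n)) pi :
  selfadjoint pi -> (D <= pi)%MS -> pi *m pi = pi ->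
  \rank (pi :&: kermx (B *m D^T))%MS = (\rank pi - \rank D)%N.
Proof.
move=> sp /submxP[E ->] pp; set D' := E *m pi.
have piB : pi *m B = B *m pi^T.
  apply/mulmx_ext => t; apply/rowP => j.
  have := sp t (delta_mx 0 j); rewrite /bform trmx_mul.
  by rewrite trmx_delta !mulmxA -!colE !mxE => ->.
have piBD : pi *m (B *m D'^T) = B *m D'^T.
  by rewrite mulmxA piB -mulmxA -trmx_mul /D' -mulmxA pp.
rewrite -(mxrank_mul_ker pi (B *m D'^T)) piBD.
by rewrite eqmxMfull ?row_full_unit ?form_unitmx // mxrank_tr addKn.
Qed.

End Symplectic.

(** * Reduction modulo a vector *)

Section MatrixSpaces.
Variables (F : fieldType) (n : nat).
Implicit Types (u v p : 'M[F]_n) (x y : 'rV[F]_n).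

Definition evalmx k (S : 'M[F]_(k, n * n)) x : 'M[F]_(k, n) :=
  S *m lin_mul_row x.
Definition annmx k (S : 'M[F]_(k, n * n)) x : 'M[F]_(n * n) :=
  (S :&: kermx (lin_mul_row x))%MS.
Definition compressmx p : 'M[F]_(n * n) := lin_mx (mulmxr p \o mulmx p).

Variables (k : nat) (S : 'M[F]_(k, n * n)).

Lemma mem_mxD u v : (mxvec u <= S)%MS -> (mxvec v <= S)%MS ->
  (mxvec (u + v) <= S)%MS.
Proof. by rewrite linearD; apply: addmx_sub. Qed.
Lemma mem_mxZ (a : F) u : (mxvec u <= S)%MS -> (mxvec (a *: u) <= S)%MS.
Proof. by rewrite linearZ; apply: scalemx_sub. Qed.
Lemma mem_mxN u : (mxvec u <= S)%MS -> (mxvec (- u) <= S)%MS.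
Proof. by rewrite -scaleN1r; apply: mem_mxZ. Qed.
Lemma mem_mxB u v : (mxvec u <= S)%MS -> (mxvec v <= S)%MS ->
  (mxvec (u - v) <= S)%MS.
Proof. by move=> Su Sv; rewrite mem_mxD ?mem_mxN. Qed.

Lemma evalmxP x y : reflect (exists2 u, (mxvec u <= S)%MS & y = x *m u)
  (y <= evalmx S x)%MS.
Proof.
apply: (iffP idP) => [/submxP[D ->]|[u Su ->]].
  exists (vec_mx (D *m S)); first by rewrite vec_mxK submxMl.
  by rewrite -[RHS]mul_vec_lin_row vec_mxK mulmxA.
by rewrite -mul_vec_lin_row submxMr.
Qed.

Lemma mem_annmx x u : (mxvec u <= annmx S x)%MS =
  (mxvec u <= S)%MS && (x *m u == 0).
Proof. by rewrite sub_capmx sub_kermx mul_vec_lin_row. Qed.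

Lemma mem_compressmx p v :
  reflect (exists2 u, (mxvec u <= S)%MS & v = p *m u *m p)
  (mxvec v <= S *m compressmx p)%MS.
Proof.
apply: (iffP idP) => [/submxP[D def_v]|[u Su ->]].
  exists (vec_mx (D *m S)); first by rewrite vec_mxK submxMl.
  apply: (can_inj mxvecK); rewrite def_v mulmxA.
  by rewrite -[D *m S in LHS]vec_mxK mul_vec_lin.
by rewrite -[p *m u *m p]/((mulmxr p \o mulmx p) u) -mul_vec_lin submxMr.
Qed.

Lemma mem_ker_compressmx p u :
  (mxvec u <= kermx (compressmx p))%MS = (p *m u *m p == 0).
Proof. by rewrite sub_kermx mul_vec_lin mxvec_eq0. Qed.

Lemma mxspace_eq0 : (forall u, (mxvec u <= S)%MS -> u = 0) -> S = 0.
Proof.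
move=> S0; apply/row_matrixP => i; rewrite row0.
by rewrite -[row i S]vec_mxK (S0 (vec_mx (row i S))) ?linear0 // vec_mxK row_sub.
Qed.

Lemma rank_evalmx x : (\rank (evalmx S x) + \rank (annmx S x))%N = \rank S.
Proof. exact: mxrank_mul_ker. Qed.

End MatrixSpaces.

(** * Trace identities on nilpotent spaces and the passage to x^perp / x *)

Section Reduction.
Variables (F : fieldType) (n : nat) (B : 'M[F]_n).
Hypothesis hchar : (2%:R : F) != 0.
Hypothesis halt : alternating_form B.
Hypothesis hnd : nondegenerate_form B.

Local Notation b := (bform B).
Local Notation sa := (selfadjoint B).
Local Notation wedge := (wedge B).
Implicit Types (x y z w t a c e f g : 'rV[F]_n) (u v pi : 'M[F]_n).

(* Subquotients x^perp / x are modelled by their orthogonal lifts, that is by the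
   selfadjoint idempotents [pi]; a space of endomorphisms of im [pi] consists of the
   matrices [u] with [pi *m u = u = u *m pi]. *)
Definition projector pi := sa pi /\ pi *m pi = pi.

Definition nil_space k pi (S : 'M[F]_(k, n * n)) := forall u,
  (mxvec u <= S)%MS -> [/\ sa u, nilpotent_mx u, pi *m u = u & u *m pi = u].

Lemma sub_projector pi x : pi *m pi = pi -> (x <= pi)%MS -> x *m pi = x.
Proof. by move=> pp /submxP[D ->]; rewrite -mulmxA pp. Qed.

Lemma nilpotent_mulmx u : nilpotent_mx u -> nilpotent_mx (u *m u).
Proof.
case=> k uk0; exists k; rewrite mulmxE -expr2 -exprM mulnC exprM uk0 expr2.
exact: mulr0.
Qed.

Lemma nilpotent_fixed0 u x : nilpotent_mx u -> x = x *m u -> x = 0.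
Proof.
case=> k uk0 xu; have : forall j, x = x *m u ^+ j.
  elim=> [|j IHj]; first by rewrite expr0 mulmx1.
  by rewrite -mulmx_exprSr mulmxA -IHj.
by move/(_ k); rewrite uk0 mulmx0.
Qed.

(** Polarization of [\tr (w *m w) = 0] at [w = u + v]. *)
Lemma nil_space_trace k pi (S : 'M[F]_(k, n * n)) u v : nil_space pi S ->
  (mxvec u <= S)%MS -> (mxvec v <= S)%MS -> \tr (u *m v) = 0.
Proof.
move=> nS Su Sv; have [_ nu _ _] := nS u Su; have [_ nv _ _] := nS v Sv.
have [_ nuv _ _] := nS _ (mem_mxD Su Sv).
have := mxtrace_nilpotent (nilpotent_mulmx nuv).
rewrite mulmxDl !mulmxDr !mxtraceD (mxtrace_nilpotent (nilpotent_mulmx nu)).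
rewrite (mxtrace_nilpotent (nilpotent_mulmx nv)).
rewrite [\tr (v *m u)]mxtrace_mulC add0r addr0 => e.
by apply: (eq_opp_eq0 hchar); apply/eqP; rewrite -addr_eq0 e.
Qed.

Lemma nil_space_cubic k pi (S : 'M[F]_(k, n * n)) u v : nil_space pi S ->
  (mxvec u <= S)%MS -> (mxvec v <= S)%MS -> \tr (u *m u *m v) = 0.
Proof.
move=> nS Su Sv; have [_ nu _ _] := nS u Su; have [_ nv _ _] := nS v Sv.
have [_ nuDv _ _] := nS _ (mem_mxD Su Sv).
have [_ nuBv _ _] := nS _ (mem_mxB Su Sv).
exact: mxtrace_sqrM_nilpotent.
Qed.

Lemma nil_space_wedge_orth k pi (S : 'M[F]_(k, n * n)) x w v : nil_space pi S ->
  (mxvec (wedge x w) <= S)%MS -> (mxvec v <= S)%MS -> b w (x *m v) = 0.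
Proof.
move=> nS Sw Sv; have [sv _ _ _] := nS v Sv.
have /eqP := nil_space_trace nS Sw Sv.
rewrite mxtrace_wedge // mulf_eq0 (negPf hchar) -sv => /eqP.
exact: bform_eq0C.
Qed.

Section Step.
Variables (pi : 'M[F]_n) (x f : 'rV[F]_n).
Hypothesis proj_pi : projector pi.
Hypothesis xpi : x *m pi = x.
Hypothesis fpi : f *m pi = f.
Hypothesis bxf : b x f = 1.

(** This removes the hyperbolic plane spanned by [x] and [f]: the image of [pi'] is the orthogonal
    of that plane in the image of [pi], a lift of x^perp / x. *)
Let pi' := pi - wedge x f.

Lemma bfx : b f x = -1.
Proof. by rewrite bform_antisym // bxf. Qed.

Lemma mul_subproj t : t *m pi' = t *m pi - b x t *: f + b f t *: x.
Proof. by rewrite mulmxBr mul_wedge opprB addrA addrAC. Qed.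

Lemma subproj_x : x *m pi' = 0.
Proof. by rewrite mul_subproj xpi halt bfx scale0r subr0 scaleN1r subrr. Qed.

Lemma subproj_f : f *m pi' = 0.
Proof. by rewrite mul_subproj fpi halt bxf scale0r addr0 scale1r subrr. Qed.

Lemma projector_subproj : projector pi'.
Proof.
have [sp pp] := proj_pi; split.
  by apply: selfadjointD => //; apply/selfadjointN/wedge_selfadjoint.
apply: mulmx_ext => t; rewrite mulmxA (mul_subproj t) mulmxDl mulmxBl.
rewrite -!scalemxAl subproj_x subproj_f !scaler0 addr0 subr0 mul_subproj.
by rewrite -mulmxA pp -!sp xpi fpi.
Qed.

Lemma subproj_pi : pi' *m pi = pi'.
Proof.
have [sp pp] := proj_pi; apply: mulmx_ext => t.
by rewrite mulmxA (mul_subproj t) mulmxDl mulmxBl -!scalemxAl xpi fpi -mulmxA pp.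
Qed.

Lemma pi_subproj : pi *m pi' = pi'.
Proof.
have [sp pp] := proj_pi; apply: mulmx_ext => t.
by rewrite mulmxA !mul_subproj -!sp xpi fpi -mulmxA pp.
Qed.

Lemma subproj_orth t : t *m pi' = t -> [/\ b x t = 0, b f t = 0 & t *m pi = t].
Proof.
have [sp' _] := projector_subproj => tp; rewrite -tp -!sp' subproj_x subproj_f.
by rewrite !bform0l; split=> //; rewrite -mulmxA subproj_pi.
Qed.

Lemma orth_subproj t : t *m pi = t -> b x t = 0 -> b f t = 0 -> t *m pi' = t.
Proof. by move=> tp bxt bft; rewrite mul_subproj tp bxt bft !scale0r subr0 addr0. Qed.

Lemma rank_subproj : \rank pi = (\rank pi').+2.
Proof.
rewrite -(mxrank_mul_ker pi pi') pi_subproj.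
have -> : \rank (pi :&: kermx pi')%MS = \rank (x + f)%MS.
  apply: eqmx_rank; apply/andP; split.
    apply/rV_subP => t; rewrite sub_capmx => /andP[tp /sub_kermxP].
    rewrite mul_subproj sub_projector //; last by case: proj_pi.
    move/eqP; rewrite -addrA addr_eq0 opprD opprK => /eqP ->.
    by rewrite addmx_sub // ?eqmx_opp scalemx_sub // ?addsmxSl ?addsmxSr.
  rewrite addsmx_sub !sub_capmx !sub_kermx subproj_x subproj_f eqxx.
  by rewrite -{1}xpi -{1}fpi !submxMl.
have fx : ~~ (f <= x)%MS.
  apply/negP => /sub_rVP[k fk]; have := bxf; rewrite fk bformZr halt mulr0.
  by move/esym/eqP; rewrite oner_eq0.
have x0 : x != 0.
  by apply/negP => /eqP x0; have := bxf; rewrite x0 bform0l => /esym/eqP; rewrite oner_eq0.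
have : (x < x + f)%MS.
  by rewrite ltmxE addsmxSl addsmx_sub submx_refl.
move/rank_ltmx; rewrite rank_rV x0 => lt1.
have := (mxrank_adds_leqif x f).1; rewrite !rank_rV; case: (f != 0) => /= le2.
  by have -> : \rank (x + f)%MS = 2%N; lia.
by move: le2; rewrite x0; lia.
Qed.

Section Annihilator.
Variable u : 'M[F]_n.
Hypotheses (su : sa u) (pu : pi *m u = u) (up : u *m pi = u) (xu : x *m u = 0).

Lemma annihilator_f : f *m u *m pi' = f *m u.
Proof.
apply: orth_subproj; first by rewrite -mulmxA up.
  by rewrite -su xu bform0l.
exact: selfadjoint_alternating.
Qed.

(** The image of [u] is orthogonal to [x], so compression loses only the value at [f] and, dually, a
    component along [x]; both are recorded by the wedge. *)
Lemma annihilator_decomp : u = pi' *m u *m pi' + wedge x (f *m u).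
Proof.
apply: mulmx_ext => t; rewrite mulmxDr !mulmxA mul_wedge (mul_subproj t).
rewrite mulmxDl mulmxBl -!scalemxAl xu scaler0 addr0 -mulmxA pu.
rewrite mulmxBl -scalemxAl annihilator_f mul_subproj -mulmxA up -!su xu bform0l.
by rewrite scale0r subr0 addrA subrK addrK.
Qed.

(** Inserting [pi'] changes an image vector of [u] only by a multiple of [x], which [u] kills. This
    is why compression commutes with powers in [compress_exp]. *)
Lemma annihilator_mul : u *m pi' *m u = u *m u.
Proof.
apply: mulmx_ext => t; rewrite !mulmxA mul_subproj -!su xu bform0l scale0r subr0.
by rewrite mulmxDl -scalemxAl xu scaler0 addr0 -mulmxA pu.
Qed.

Lemma compress_exp k : (pi' *m u *m pi') ^+ k.+1 = pi' *m u ^+ k.+1 *m pi'.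
Proof.
have [_ pp] := projector_subproj.
elim: k => [|k IHk]; first by rewrite !expr1.
rewrite exprSr IHk -mulmxE -!mulmx_exprSr !mulmxA; congr (_ *m _).
rewrite -[_ *m pi' *m pi']mulmxA pp -!mulmxA; do 2!congr (_ *m _).
by rewrite !mulmxA annihilator_mul.
Qed.

Lemma compress_nilpotent : nilpotent_mx u -> nilpotent_mx (pi' *m u *m pi').
Proof.
by case=> k uk0; exists k.+1; rewrite compress_exp exprS uk0 mulr0 mulmx0 mul0mx.
Qed.

End Annihilator.

Variables (k : nat) (S : 'M[F]_(k, n * n)).
Hypothesis nS : nil_space pi S.

Definition reduction := annmx S x *m compressmx pi'.

Lemma mem_annmx_nil u : (mxvec u <= annmx S x)%MS ->
  [/\ (mxvec u <= S)%MS, x *m u = 0, sa u, nilpotent_mx u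
    & pi *m u = u /\ u *m pi = u].
Proof. by rewrite mem_annmx => /andP[Su /eqP xu]; have [] := nS Su. Qed.

Lemma reduction_nil : nil_space pi' reduction.
Proof.
have [sp' pp'] := projector_subproj.
move=> v /mem_compressmx[u Su ->].
have [_ xu su nu [pu up]] := mem_annmx_nil Su; split.
- exact: selfadjoint_conj.
- exact: compress_nilpotent.
- by rewrite !mulmxA pp'.
- by rewrite -!mulmxA pp'.
Qed.

Hypothesis forth : forall u, (mxvec u <= S)%MS -> b f (x *m u) = 0.

Lemma eval_subproj u : (mxvec u <= S)%MS -> x *m u *m pi' = x *m u.
Proof.
move=> Su; have [su nu pu up] := nS Su; apply: orth_subproj.
- by rewrite -mulmxA up.
- exact: selfadjoint_alternating.
- exact: forth.
Qed.

(** The kernel of the reduction; its elements are wedges with [x]. *)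
Let K := (annmx S x :&: kermx (compressmx pi'))%MS.

Lemma mem_K u : (mxvec u <= K)%MS -> (mxvec u <= S)%MS /\ u = wedge x (f *m u).
Proof.
rewrite sub_capmx mem_ker_compressmx => /andP[/mem_annmx_nil[Su xu su nu [pu up]]].
by move=> /eqP cu; split=> //; rewrite {1}(annihilator_decomp su pu up xu) cu add0r.
Qed.

Lemma rank_wedge_part : \rank K = \rank (evalmx K f).
Proof.
rewrite -(rank_evalmx K f); have -> : annmx K f = 0; last by rewrite mxrank0 addn0.
apply: mxspace_eq0 => u; rewrite mem_annmx => /andP[/mem_K[_ uE] /eqP fu].
by rewrite uE fu wedge0r.
Qed.

(** Trace isotropy against [wedge x w] makes [w] orthogonal to [x S]. *)
Lemma wedge_part_sub : (evalmx K f <= pi' :&: kermx (B *m (evalmx S x)^T))%MS.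
Proof.
apply/rV_subP => w /evalmxP[u Ku ->]; have [Su uE] := mem_K Ku.
move: (Ku); rewrite {1}/K sub_capmx => /andP[/mem_annmx_nil[_ xu su nu [pu up]] _].
rewrite sub_capmx -{1}(annihilator_f su up xu) submxMl /=.
apply/sub_kermxP; apply/rowP => j; rewrite [RHS]mxE.
have /evalmxP[v Sv def_v] : (row j (evalmx S x) <= evalmx S x)%MS by exact: row_sub.
have <- : b (f *m u) (row j (evalmx S x)) = 0.
  by rewrite def_v; apply: (nil_space_wedge_orth nS) => //; rewrite -uE.
by rewrite /bform mulmxA tr_row colE mulmxA -colE [RHS]mxE.
Qed.


Lemma rank_reduction_eq :
  \rank S = (\rank (evalmx S x) + (\rank (evalmx K f) + \rank reduction))%N.
Proof.
rewrite -(rank_evalmx S x) -(mxrank_mul_ker (annmx S x) (compressmx pi')).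
by rewrite -rank_wedge_part addnC [(\rank K + _)%N]addnC -/K [RHS]addnC.
Qed.

Lemma eval_sub_subproj : (evalmx S x <= pi')%MS.
Proof.
by apply/rV_subP => t /evalmxP[u Su ->]; rewrite -eval_subproj // submxMl.
Qed.

Lemma rank_wedge_orth :
  \rank (pi' :&: kermx (B *m (evalmx S x)^T))%MS
    = (\rank pi' - \rank (evalmx S x))%N.
Proof.
have [sp' pp'] := projector_subproj.
exact: (selfadjoint_orth_rank hnd sp' eval_sub_subproj pp').
Qed.

(** [x S] and the wedge part are mutually orthogonal in the nondegenerate image of [pi'], so their
    dimensions add up to at most [\rank pi']. *)
Lemma rank_reduction_le : (\rank S <= \rank pi' + \rank reduction)%N.
Proof.
rewrite rank_reduction_eq addnA leq_add2r.
have := mxrankS wedge_part_sub; rewrite rank_wedge_orth.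
by have := mxrankS eval_sub_subproj; lia.
Qed.

(** Equality forces the wedge part to be the whole orthogonal of [x S] in the image of [pi'].
    Replacing [w] by [w *m pi'] only adds a multiple of [x], invisible in [wedge x w]. *)
Lemma rank_reduction_max w : \rank S = (\rank pi' + \rank reduction)%N ->
  w *m pi = w -> b x w = 0 -> (forall u, (mxvec u <= S)%MS -> b w (x *m u) = 0) ->
  (mxvec (wedge x w) <= S)%MS.
Proof.
have [sp' pp'] := projector_subproj; have [sp pp] := proj_pi.
move=> maxS wp bxw worth.
have : (evalmx K f == pi' :&: kermx (B *m (evalmx S x)^T))%MS.
  rewrite -(mxrank_leqif_eq wedge_part_sub) rank_wedge_orth.
  have := mxrankS wedge_part_sub; have := mxrankS eval_sub_subproj.
  by rewrite rank_wedge_orth; move: maxS; rewrite rank_reduction_eq; lia.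
case/andP=> _ sub_K; pose w' := w *m pi'.
have w'E : w' = w + b f w *: x.
  by rewrite /w' mul_subproj wp bxw scale0r subr0.
have : (w' <= evalmx K f)%MS.
  apply: submx_trans sub_K; rewrite sub_capmx submxMl /=.
  apply/sub_kermxP; apply/rowP => j; rewrite [RHS]mxE.
  have /evalmxP[v Sv def_v] : (row j (evalmx S x) <= evalmx S x)%MS by exact: row_sub.
  have <- : b w' (row j (evalmx S x)) = 0.
    have [sv _ _ _] := nS Sv.
    by rewrite def_v w'E !bformE worth // (selfadjoint_alternating _ _ sv) // mulr0 addr0.
  by rewrite /bform mulmxA tr_row colE mulmxA -colE [RHS]mxE.
case/evalmxP => u /mem_K[Su uE] def_w'.
have -> : wedge x w = wedge x w' by rewrite w'E wedgeDr wedgeZr wedgexx scaler0 addr0.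
by rewrite def_w' -uE.
Qed.

End Step.

(** Nilpotency keeps a nonzero [x] out of [x S], so some vector is orthogonal to [x S] but not to
    [x]. With this choice of [f], [x S] lies in the image of the reduced projector. *)
Lemma exists_dual k pi (S : 'M[F]_(k, n * n)) x : projector pi -> nil_space pi S ->
  x != 0 -> x *m pi = x ->
  exists f, [/\ f *m pi = f, b x f = 1 &
    forall u, (mxvec u <= S)%MS -> b f (x *m u) = 0].
Proof.
move=> [sp pp] nS x0 xpi.
have : ~~ (x <= evalmx S x)%MS.
  apply/negP => /evalmxP[u Su xu]; have [_ nu _ _] := nS u Su.
  by case/eqP: x0; apply: nilpotent_fixed0 xu.
case/(bform_separate hnd) => w [w_orth bwx]; exists (- w *m pi); split.
- by rewrite -mulmxA pp.
- by rewrite -sp xpi bform_antisym // bformNl bwx opprK.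
- move=> u Su; have [_ _ _ up] := nS u Su.
  rewrite sp -mulmxA up bformNl w_orth ?oppr0 //.
  by apply/evalmxP; exists u.
Qed.

Lemma rank0_nil_space k pi (S : 'M[F]_(k, n * n)) :
  \rank pi = 0%N -> nil_space pi S -> S = 0.
Proof.
move/eqP; rewrite mxrank_eq0 => /eqP pi0 nS; apply: mxspace_eq0 => u /nS[_ _ <- _].
by rewrite pi0 mul0mx.
Qed.

(** The induction step is [2 mu + mu (mu - 1) = (mu + 1) mu]. *)
Lemma nil_space_rank_le mu k pi (S : 'M[F]_(k, n * n)) :
  projector pi -> \rank pi = mu.*2 -> nil_space pi S ->
  (\rank S <= mu * mu.-1)%N.
Proof.
elim: mu k pi S => [|mu IHmu] k pi S proj_pi rk_pi nS.
  by rewrite (rank0_nil_space rk_pi nS) mxrank0.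
have [x x0 xpi] : exists2 x : 'rV[F]_n, x != 0 & x *m pi = x.
  have /rowV0Pn[x xp x0] : pi != 0 by rewrite -mxrank_eq0 rk_pi.
  by exists x => //; apply: sub_projector xp; case: proj_pi.
have [f [fpi bxf forth]] := exists_dual proj_pi nS x0 xpi.
have rk' : \rank (pi - wedge x f) = mu.*2.
  by have := rank_subproj proj_pi xpi fpi bxf; rewrite rk_pi doubleS => -[].
have proj' := projector_subproj proj_pi xpi fpi bxf.
have := IHmu _ _ _ proj' rk' (reduction_nil proj_pi xpi fpi bxf nS).
have := rank_reduction_le proj_pi xpi fpi bxf nS forth; rewrite rk'.
by case: (mu) => [|m] /=; nia.
Qed.

End Reduction.

(** * Spaces of maximal dimension *)

Section Extremal.
Variables (F : fieldType) (n : nat) (B : 'M[F]_n).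
Hypothesis hchar : (2%:R : F) != 0.
Hypothesis halt : alternating_form B.
Hypothesis hnd : nondegenerate_form B.

Local Notation b := (bform B).
Local Notation sa := (selfadjoint B).
Local Notation wedge := (wedge B).
Implicit Types (x y z w t a c e f g : 'rV[F]_n) (u v pi : 'M[F]_n).

Definition extremal mu k pi (S : 'M[F]_(k, n * n)) :=
  [/\ projector B pi, \rank pi = mu.*2, nil_space B pi S
    & \rank S = (mu * mu.-1)%N].

(** Quantifying over every stable [D] is what lets the descent find the killed vector inside
    [x S]. *)
Definition common_kernel_property k pi (S : 'M[F]_(k, n * n)) :=
  forall m (D : 'M[F]_(m, n)), (D <= pi)%MS -> D != 0 ->
    (forall u, (mxvec u <= S)%MS -> (D *m u <= D)%MS) ->
  exists y, [/\ y != 0, (y <= D)%MS &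
    forall u, (mxvec u <= S)%MS -> y *m u = 0].

(** Spanning by the wedges contained in [S], phrased through test spaces [T] so that no spanning
    family has to be exhibited. *)
Definition wedge_spanned k pi (S : 'M[F]_(k, n * n)) :=
  forall m (T : 'M[F]_(m, n * n)),
    (forall a c, a *m pi = a -> c *m pi = c ->
       (mxvec (wedge a c) <= S)%MS -> (mxvec (wedge a c) <= T)%MS) ->
  (S <= T)%MS.

Lemma extremal_gt0 mu k pi (S : 'M[F]_(k, n * n)) x :
  extremal mu pi S -> x != 0 -> x *m pi = x -> (0 < mu)%N.
Proof.
case: mu => // -[_ /eqP]; rewrite mxrank_eq0 => /eqP -> _ _ x0 /eqP.
by rewrite mulmx0 eq_sym (negPf x0).
Qed.

(** With [S'] the reduction, [(mu + 1) mu = \rank S <= 2 mu + \rank S' <= 2 mu + mu (mu - 1)] is a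
    chain of equalities. *)
Lemma extremal_reduction mu k pi (S : 'M[F]_(k, n * n)) x f :
  extremal mu.+1 pi S -> x *m pi = x -> f *m pi = f -> b x f = 1 ->
  (forall u, (mxvec u <= S)%MS -> b f (x *m u) = 0) ->
  extremal mu (pi - wedge x f) (reduction B pi x f S) /\
  \rank S = (\rank (pi - wedge x f)%R + \rank (reduction B pi x f S))%N.
Proof.
move=> [proj_pi rk_pi nS rkS] xpi fpi bxf forth.
have rk' : \rank (pi - wedge x f) = mu.*2.
  by have := rank_subproj hchar halt proj_pi xpi fpi bxf; rewrite rk_pi doubleS => -[].
have proj' := projector_subproj halt proj_pi xpi fpi bxf.
have nS' := reduction_nil halt proj_pi xpi fpi bxf nS.
have le' := nil_space_rank_le hchar halt hnd proj' rk' nS'.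
have := rank_reduction_le hchar halt hnd proj_pi xpi fpi bxf nS forth.
rewrite rkS rk' => le_red.
have eq_red : \rank (reduction B pi x f S) = (mu * mu.-1)%N.
  by case: (mu) le' le_red => [|m] /=; nia.
split; first by split.
by rewrite eq_red; case: (mu) => [|m] /=; nia.
Qed.

(** * Orbits of a vector under an extremal space *)

Section Vector.
Variables (mu k : nat) (pi : 'M[F]_n) (S : 'M[F]_(k, n * n)) (x : 'rV[F]_n).
Hypothesis extS : extremal mu pi S.
Hypothesis x0 : x != 0.
Hypothesis xpi : x *m pi = x.

Lemma extremal_wedge w : w *m pi = w -> b x w = 0 ->
  (forall u, (mxvec u <= S)%MS -> b w (x *m u) = 0) ->
  (mxvec (wedge x w) <= S)%MS.
Proof.
move=> wpi bxw w_orth; have := extremal_gt0 extS x0 xpi.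
case: mu extS => // m ext _; have [proj_pi rk_pi nS rkS] := ext.
have [f [fpi bxf forth]] := exists_dual halt hnd proj_pi nS x0 xpi.
have [_ rk_eq] := extremal_reduction ext xpi fpi bxf forth.
exact: (rank_reduction_max hchar halt hnd proj_pi xpi fpi bxf nS forth rk_eq).
Qed.

(** A vector [w] separating [t] from [x S + <x>] would, by [extremal_wedge], give a wedge in [S] and
    hence be orthogonal to [t]. *)
Lemma extremal_biorth t : t *m pi = t ->
  (forall w, (mxvec (wedge x w) <= S)%MS -> b w t = 0) ->
  (t <= evalmx S x + x)%MS.
Proof.
have [[sp pp] rk_pi nS rkS] := extS.
move=> tpi t_orth; apply/negPn/negP => /(bform_separate hnd)[w [w_orth bwt]].
have : b (w *m pi) t = 0.
  apply: t_orth; apply: extremal_wedge; first by rewrite -mulmxA pp.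
    by rewrite -sp xpi bform_eq0C // w_orth // addsmxSr.
  move=> u Su; have [_ _ _ up] := nS u Su; rewrite sp -mulmxA up w_orth //.
  by apply: submx_trans (addsmxSl _ _); apply/evalmxP; exists u.
by rewrite sp tpi bwt => /eqP; rewrite oner_eq0.
Qed.

(** For each [wedge x w] in [S], [v - wedge x w] is nilpotent, and on the [v]-orbit of [x] the wedge
    takes values in the line of [x]. The rank-one perturbation lemma forces [b w (x *m v ^+ j) = 0],
    and double orthogonality concludes. *)
Lemma extremal_orbit v j : (mxvec v <= S)%MS ->
  (x *m v ^+ j <= evalmx S x + x)%MS.
Proof.
have [[sp pp] rk_pi nS rkS] := extS.
move=> Sv; have [sv nv pv vp] := nS v Sv.
case: j => [|j]; first by rewrite expr0 mulmx1 addsmxSr.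
apply: extremal_biorth => [|w Sw].
  by rewrite exprSr -mulmxE -!mulmxA vp.
have [_ nvw _ _] : [/\ sa (v - wedge x w), nilpotent_mx (v - wedge x w),
    pi *m (v - wedge x w) = v - wedge x w & (v - wedge x w) *m pi = v - wedge x w].
  by apply: nS; apply: mem_mxB.
have orb i : x *m v ^+ i *m - wedge x w = b w (x *m v ^+ i) *: x.
  rewrite -wedgeC mul_wedge.
  have -> : b x (x *m v ^+ i) = 0.
    by apply: selfadjoint_alternating => //; apply: selfadjoint_exp.
  by rewrite scale0r subr0.
have := @rank_one_perturbation_cyclic F n v (- wedge x w) x j.+1 nv nvw.
rewrite orb => /(_ _)/eqP; rewrite scaler_eq0 (negPf x0) orbF => orb0.
by apply/eqP/orb0 => i; rewrite orb scalemx_sub.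
Qed.

(** Exponent 2 of [extremal_orbit] suffices: as [x u = 0], [x (u + v)^2 - x v^2 = x v u]. *)
Lemma extremal_annmx_stable u v : (mxvec u <= annmx S x)%MS ->
  (mxvec v <= S)%MS -> (x *m v *m u <= evalmx S x + x)%MS.
Proof.
rewrite mem_annmx => /andP[Su /eqP xu] Sv.
have := extremal_orbit 2 Sv; have := extremal_orbit 2 (mem_mxD Su Sv).
rewrite !expr2 -!mulmxE !mulmxA [x *m (u + v)]mulmxDr xu add0r mulmxDr => Suv Svv.
by rewrite -[_ *m u](addrK (x *m v *m v)) addmx_sub // eqmx_opp.
Qed.

End Vector.

(** * The action of the annihilator of [x] on [x S] *)

Section Descent.
Variables (mu k : nat) (pi : 'M[F]_n) (S : 'M[F]_(k, n * n)) (x f : 'rV[F]_n).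
Hypothesis extS : extremal mu.+1 pi S.
Hypothesis x0 : x != 0.
Hypothesis xpi : x *m pi = x.
Hypothesis fpi : f *m pi = f.
Hypothesis bxf : b x f = 1.
Hypothesis forth : forall u, (mxvec u <= S)%MS -> b f (x *m u) = 0.

Let pi' := pi - wedge x f.
Let S' := reduction B pi x f S.
Let D := evalmx S x.

Let proj_pi : projector B pi. Proof. by case: extS. Qed.
Let nS : nil_space B pi S. Proof. by case: extS. Qed.
Let ext' : extremal mu pi' S'.
Proof. by have [] := extremal_reduction extS xpi fpi bxf forth. Qed.
Let proj' : projector B pi'. Proof. by case: ext'. Qed.
Let nS' : nil_space B pi' S'. Proof. by case: ext'. Qed.

Lemma D_subproj t : (t <= D)%MS -> t *m pi' = t.
Proof. by case/evalmxP => v Sv ->; apply: (eval_subproj hchar halt nS forth). Qed.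

Lemma annmx_mul t u : (mxvec u <= annmx S x)%MS -> t *m pi' = t ->
  t *m u = t *m (pi' *m u *m pi') + b (t *m u) f *: x.
Proof.
move=> Au tp'; have [Su xu su nu [pu up]] := mem_annmx_nil nS Au.
have [bxt bft tp] := subproj_orth halt proj_pi xpi fpi bxf tp'.
rewrite {1}(annihilator_decomp hchar halt f su pu up xu).
rewrite mulmxDr mul_wedge bxt scale0r add0r -scaleNr; congr (_ + _ *: _).
by rewrite -bform_antisym // su.
Qed.

Lemma mem_reduction u : (mxvec u <= annmx S x)%MS ->
  (mxvec (pi' *m u *m pi') <= S')%MS.
Proof. by move=> Au; apply/mem_compressmx; exists u. Qed.

(** Stability modulo [x] comes from [extremal_annmx_stable]; the coefficient along [x] vanishes by
    pairing with [f], which is orthogonal to [x S] and to the image of [pi']. *)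
Lemma D_stable u : (mxvec u <= S')%MS -> (D *m u <= D)%MS.
Proof.
move=> /mem_compressmx[v Av ->]; apply/rV_subP => t /submxP[E ->].
rewrite mulmxA; set d := E *m D.
have dD : (d <= D)%MS by rewrite submxMl.
have := annmx_mul Av (D_subproj dD); rewrite -/pi' => dv.
have : (d *m (pi' *m v *m pi') <= D + x)%MS.
  have -> : d *m (pi' *m v *m pi') = d *m v - b (d *m v) f *: x by rewrite {1}dv addrK.
  rewrite addmx_sub ?eqmx_opp ?scalemx_sub ?addsmxSr //.
  case/evalmxP: (dD) => w Sw ->.
  exact: (extremal_annmx_stable extS).
case/sub_addsmxP => -[E1 E2] /= dE.
have b0 : b (E2 *m x) f = 0.
  have <- : b (d *m (pi' *m v *m pi')) f = 0.
    by rewrite mulmxA (proj'.1 _ f) (subproj_f halt fpi bxf) bform0r.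
  rewrite dE bformDl; have /evalmxP[w Sw ->] : (E1 *m D <= D)%MS by rewrite submxMl.
  by rewrite [b (x *m w) f]bform_eq0C ?forth ?add0r.
move: b0; rewrite [E2]mx11_scalar mul_scalar_mx bformZl bxf mulr1 => E20.
by rewrite dE [E2]mx11_scalar E20 mul_scalar_mx scale0r addr0 submxMl.
Qed.

(* The form of the cubic trace identity that is used: the square of an element
   annihilating [x] is determined on [x S] by its reduction. *)
Lemma annmx_square u u1 d : (mxvec u <= annmx S x)%MS ->
  (mxvec u1 <= annmx S x)%MS ->
  (pi' *m u *m pi') *m (pi' *m u *m pi') = pi' *m u1 *m pi' ->
  (d <= D)%MS -> b (d *m (pi' *m u *m pi') *m u) f = b (d *m u1) f.
Proof.
move=> Au Au1 eqN dD.
have [Su xu su nu [pu up]] := mem_annmx_nil nS Au.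
have [Su1 xu1 su1 nu1 [pu1 up1]] := mem_annmx_nil nS Au1.
(* [z] has zero reduction, so it is a wedge with [x], and the cubic and quadratic trace identities
   give [\tr (z *m v) = 0]. *)
pose z := u *m u - u1.
have sz : sa z.
  apply: selfadjointD; last exact: selfadjointN.
  by move=> s t; rewrite !mulmxA !su.
have pz : pi *m z = z by rewrite mulmxBr mulmxA pu pu1.
have zp : z *m pi = z by rewrite mulmxBl -mulmxA up up1.
have xz : x *m z = 0 by rewrite mulmxBr mulmxA xu xu1 mul0mx subrr.
have [_ pp'] := proj'.
have zE : z = wedge x (f *m z).
  rewrite {1}(annihilator_decomp hchar halt f sz pz zp xz) -/pi'.
  suff -> : pi' *m z *m pi' = 0 by rewrite add0r.
  rewrite /z (mulmxBr pi') (mulmxBl (pi' *m (u *m u))) -eqN -(annihilator_mul f su pu xu) -/pi'.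
  by rewrite !mulmxA -[_ *m pi' *m pi']mulmxA pp' subrr.
have [v Sv dE] : exists2 v, (mxvec v <= S)%MS & d = x *m v by apply/evalmxP.
have bz : b (x *m v) (f *m z) = 0.
  have [sv _ _ _] := nS Sv; apply/eqP; rewrite sv.
  have : \tr (z *m v) == 0.
    rewrite mulmxBl raddfB /= (nil_space_cubic hchar nS Su Sv).
    by rewrite (nil_space_trace hchar nS Su1 Sv) subr0.
  by rewrite {1}zE mxtrace_wedge // mulf_eq0 (negPf hchar).
have -> : d *m (pi' *m u *m pi') *m u = d *m u *m u.
  by rewrite [d *m u in RHS](annmx_mul Au (D_subproj dD)) mulmxDl -scalemxAl xu
    scaler0 addr0.
apply/eqP; rewrite -subr_eq0 -bformNl -bformDl -mulmxA -mulmxBr -/z dE.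
by rewrite sz bz.
Qed.

(** * A vector [y] of [x S] killed by the reduction *)

Section CommonVector.
Variables (y : 'rV[F]_n) (v : 'M[F]_n).
Hypothesis Sv : (mxvec v <= S)%MS.
Hypothesis def_y : y = x *m v.
Hypothesis y0 : y != 0.
Hypothesis yS' : forall u, (mxvec u <= S')%MS -> y *m u = 0.

Let yD : (y <= D)%MS. Proof. by apply/evalmxP; exists v. Qed.

(** As [S'] kills [y], its extremality at [y] leaves orthogonality to [y] as the only condition on
    [z]. *)
Lemma wedge_y z : z *m pi' = z -> b y z = 0 ->
  exists2 u, (mxvec u <= annmx S x)%MS & pi' *m u *m pi' = wedge y z.
Proof.
move=> zp byz; have : (mxvec (wedge y z) <= S')%MS.
  apply: (extremal_wedge ext' y0 (D_subproj yD) zp byz) => u S'u.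
  by rewrite yS' // bform0r.
by case/mem_compressmx => u Au ->; exists u.
Qed.

(* Under this hypothesis [u] maps all the [x *m v ^+ i] to multiples of [x]. *)
Lemma annmx_orbit u : (mxvec u <= annmx S x)%MS ->
  (forall d, (d <= D)%MS -> b d y = 0 -> d *m (pi' *m u *m pi') = 0) ->
  b (y *m u) f = 0.
Proof.
move=> Au uD; have [Su xu su nu _] := mem_annmx_nil nS Au.
have [sv nv _ _] := nS Sv.
have [_ nvu _ _] := nS (mem_mxD Sv Su).
have := @rank_one_perturbation_cyclic F n v u x 1 nv nvu.
rewrite expr1 -def_y => ->; first by rewrite bform0l.
move=> i; have := extremal_orbit extS x0 xpi i Sv.
case/sub_addsmxP => -[E1 E2] /= vE; set d := E1 *m evalmx S x in vE.
have dD : (d <= D)%MS by rewrite submxMl.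
have E2x : E2 *m x = E2 0 0 *: x by rewrite [E2]mx11_scalar mul_scalar_mx mxE.
have bdy : b d y = 0.
  have -> : d = x *m v ^+ i - E2 0 0 *: x by rewrite vE E2x addrK.
  rewrite !bformE def_y (selfadjoint_exp i sv) -mulmxA mulmx_exprS.
  rewrite (selfadjoint_alternating hchar halt (selfadjoint_exp i.+1 sv)).
  by rewrite (selfadjoint_alternating hchar halt sv) mulr0 subr0.
rewrite vE E2x mulmxDl -scalemxAl xu scaler0 addr0.
by rewrite (annmx_mul Au (D_subproj dD)) uD // add0r scalemx_sub.
Qed.

(* The squares of the elements of S reducing to [wedge a c], [wedge y c],
   [wedge (a + y) c] and [wedge a c + wedge y g] (with [b g a = 1] and [g] orthogonal
   to [c] and [y]) give both [b (y *m u) f = - b (a *m u2) f] and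
   [b (y *m u) f = b (a *m u2) f], where [u2] reduces to [wedge y c]. *)
Lemma annmx_wedge_core a c e u : a *m pi' = a -> c *m pi' = c ->
  (a <= D)%MS -> (e <= D)%MS -> b a e = 0 -> b c e = 1 -> b y e = 0 ->
  b y a = 0 -> b y c = 0 -> b a c = 0 -> (mxvec u <= annmx S x)%MS ->
  pi' *m u *m pi' = wedge a c -> b (y *m u) f = 0.
Proof.
move=> ap cp aD eD bae bce bye bya byc bac Au uN.
(* The wedge of orthogonal vectors squares to zero, so [annmx_square] applies with [u1 = 0]; [t] is
   such that [t *m wedge z w = - z]. *)
have sq0 z w t u' : (mxvec u' <= annmx S x)%MS -> pi' *m u' *m pi' = wedge z w ->
    b z w = 0 -> (t <= D)%MS -> b z t = 0 -> b w t = 1 -> b (z *m u') f = 0.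
  move=> Au' u'N bzw tD bzt bwt.
  have A0 : (mxvec (0 : 'M[F]_n) <= annmx S x)%MS by rewrite linear0 sub0mx.
  have := annmx_square Au' A0; rewrite u'N wedge_square // mulmx0 mul0mx.
  move/(_ t erefl tD); rewrite mul_wedge bzt bwt scale0r scale1r add0r mulNmx.
  by rewrite mulmx0 bform0l bformNl => /eqP; rewrite oppr_eq0 => /eqP.
have au := sq0 a c e u Au uN bac eD bae bce.
have [u2 Au2 u2N] := wedge_y cp byc.
have yu2 := sq0 y c e u2 Au2 u2N byc eD bye bce.
have u12N : pi' *m (u + u2) *m pi' = wedge (a + y) c.
  by rewrite (mulmxDr pi') (mulmxDl (pi' *m u)) uN u2N wedgeDl.
have yu_au2 : b (y *m u) f + b (a *m u2) f = 0.
  have := sq0 (a + y) c e (u + u2) (mem_mxD Au Au2) u12N.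
  rewrite !bformE bac byc bae bye addr0 => /(_ erefl eD erefl bce).
  rewrite mulmxDl !mulmxDr !bformE au yu2 add0r addr0.
  by rewrite addrC.
(* In this degenerate case, pairing with [e] shows that [a] is a multiple of [y]: either [au]
   concludes or [u] has zero reduction. *)
have [a_cy|] := boolP (a <= c + y)%MS.
  have [k1 [k2 aE]] : exists k1 k2, a = k1 *: c + k2 *: y.
    case/sub_addsmxP: a_cy => -[E1 E2] /= ->; exists (E1 0 0), (E2 0 0).
    by rewrite {1}[E1]mx11_scalar {1}[E2]mx11_scalar !mul_scalar_mx.
  have k10 : k1 = 0.
    by move: bae; rewrite aE !bformE bce bye mulr1 mulr0 addr0.
  move: aE au; rewrite k10 scale0r add0r => aE.
  rewrite aE -scalemxAl bformZl => /eqP; rewrite mulf_eq0 => /orP[/eqP k20|/eqP //].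
  have u0 : pi' *m u *m pi' = 0.
    by rewrite uN aE k20 scale0r wedgeC wedge0r oppr0.
  by apply: annmx_orbit => // d _ _; rewrite u0 mulmx0.
case/(bform_separate hnd) => g0 [g0_orth bg0a]; pose g := g0 *m pi'.
have [sp' pp'] := proj'.
have gp : g *m pi' = g by rewrite /g -mulmxA pp'.
have bga : b g a = 1 by rewrite /g sp' ap.
have bgc : b g c = 0 by rewrite /g sp' cp g0_orth // addsmxSl.
have bgy : b g y = 0 by rewrite /g sp' (D_subproj yD) g0_orth // addsmxSr.
have byg : b y g = 0 by apply: bform_eq0C.
have [u3 Au3 u3N] := wedge_y gp byg.
have yu3 := sq0 y g a u3 Au3 u3N byg aD bya bga.
have u13N : pi' *m (u + u3) *m pi' = wedge a c + wedge y g.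
  by rewrite (mulmxDr pi') (mulmxDl (pi' *m u)) uN u3N.
have bag : b a g = -1 by rewrite bform_antisym // bga.
have sq13 : (wedge a c + wedge y g) *m (wedge a c + wedge y g) = pi' *m (- u2) *m pi'.
  rewrite (mulmxN pi') (mulNmx (pi' *m u2)) u2N; apply: mulmx_ext => t.
  have N1 s : s *m (wedge a c + wedge y g) =
      b a s *: c - b c s *: a + (b y s *: g - b g s *: y).
    by rewrite mulmxDr !mul_wedge.
  rewrite mulmxA (N1 t) mulmxDl !mulmxBl -!scalemxAl !N1 !halt mulmxN mul_wedge.
  rewrite bac byc bgc bga bag bya byg bgy (bform_eq0C halt bac) (bform_eq0C halt bya).
  rewrite (bform_eq0C halt byc) (bform_eq0C halt bgc) !scale0r scale1r scaleN1r.
  rewrite !(subr0, add0r, addr0, sub0r, scaler0, oppr0, scalerN, opprK, opprB).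
  by [].
have := annmx_square (mem_mxD Au Au3) (mem_mxN Au2); rewrite u13N sq13.
move/(_ a erefl aD); rewrite [a *m (wedge a c + _)]mulmxDr !mul_wedge halt bya bga (bform_eq0C halt bac).
rewrite !scale0r scale1r subr0 !add0r mulNmx mulmxN !bformNl mulmxDr bformDl yu3 addr0.
move/oppr_inj => yu; apply: (eq_opp_eq0 hchar); apply/eqP.
by rewrite -addr_eq0 {2}yu yu_au2.
Qed.

(** If the wedge kills the part [W] of [D] orthogonal to [y], [annmx_orbit] applies. Otherwise some
    [e] in [W] has a nonzero image, which lies in [D] by [D_stable]; rewriting the wedge with the
    opposite of this image as first factor meets the hypotheses of [annmx_wedge_core]. *)
Lemma annmx_wedge a c u : a *m pi' = a -> c *m pi' = c ->
  (mxvec u <= annmx S x)%MS -> pi' *m u *m pi' = wedge a c -> b (y *m u) f = 0.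
Proof.
move=> ap cp Au uN; have S'w : (mxvec (wedge a c) <= S')%MS.
  by rewrite -uN; apply: mem_reduction.
have [_ /(wedge_nilpotent_orth halt) bac _ _] := nS' S'w.
pose W := (D :&: kermx (B *m y^T))%MS.
have WP t : (t <= W)%MS = (t <= D)%MS && (b t y == 0).
  rewrite sub_capmx sub_kermx; congr (_ && _); rewrite /bform mulmxA.
  apply/eqP/eqP => [->|ty0]; first by rewrite mxE.
  by rewrite [LHS]mx11_scalar ty0 raddf0.
have [WN|] := eqVneq (W *m wedge a c) 0.
  apply: annmx_orbit => // d dD bdy; rewrite uN.
  have /submxP[E ->] : (d <= W)%MS by rewrite WP dD bdy eqxx.
  by rewrite -mulmxA WN mulmx0.
case/rowV0Pn => t /submxP[E ->]; rewrite mulmxA; set e := E *m W => eN0.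
have /andP[eD /eqP bey] : (e <= D)%MS && (b e y == 0) by rewrite -WP submxMl.
(* Neither of [a], [c] is a multiple of the other, so [y *m wedge a c = 0] makes both orthogonal to
   [y]. *)
have indep (k1 : F) : a != k1 *: c.
  apply: contraNneq eN0 => ->; by rewrite wedgeC wedgeZr wedgexx scaler0 oppr0 mulmx0.
have indep' (k1 : F) : c != k1 *: a.
  apply: contraNneq eN0 => ->; by rewrite wedgeZr wedgexx scaler0 mulmx0.
have yN : b a y *: c - b c y *: a = 0 by rewrite -mul_wedge yS'.
have bcy : b c y = 0.
  apply/eqP; apply: contraT => bcy; case/eqP: (indep ((b c y)^-1 * b a y)).
  apply/eqP; rewrite -scalerA; move/eqP: yN; rewrite subr_eq0 => /eqP ->.
  by rewrite scalerA mulVf // scale1r.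
have bay : b a y = 0.
  apply/eqP; apply: contraT => bay; move: yN; rewrite bcy scale0r subr0 => /eqP.
  rewrite scaler_eq0 (negPf bay) /= => /eqP c0.
  by have := indep' 0; rewrite c0 scale0r eqxx.
have [bya byc bye] : [/\ b y a = 0, b y c = 0 & b y e = 0].
  by split; apply: bform_eq0C.
pose ga := b c e; pose al := b a e; pose a0 := ga *: a - al *: c.
have a0E : a0 = - (e *m wedge a c) by rewrite mul_wedge opprB.
have a0D : (a0 <= D)%MS.
  rewrite a0E eqmx_opp; apply: submx_trans (D_stable S'w).
  by rewrite submxMr.
have a0p : a0 *m pi' = a0 by apply: D_subproj.
(* When [ga = 0], [a0] is a multiple of [c], so a multiple of [a] serves as second factor; otherwise
   a multiple of [c] does. *)
have [ga0|ga0] := eqVneq ga 0.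
  have al0 : al != 0.
    apply: contraNneq eN0 => al0; rewrite mul_wedge -/ga -/al ga0 al0 !scale0r.
    by rewrite subrr.
  apply: (@annmx_wedge_core a0 (al^-1 *: a) e u) => //.
  - by rewrite -scalemxAl ap.
  - by rewrite /a0 !bformE -/ga -/al ga0; ring.
  - by rewrite bformZl -/al mulVf.
  - by rewrite /a0 !bformE bya byc; ring.
  - by rewrite bformZr bya mulr0.
  - by rewrite /a0 !bformE halt (bform_eq0C halt bac); ring.
  rewrite uN /a0 ga0 scale0r add0r -scaleNr wedgeZl wedgeZr scalerA mulNr.
  by rewrite divff // scaleN1r -wedgeC.
apply: (@annmx_wedge_core a0 (ga^-1 *: c) e u) => //.
- by rewrite -scalemxAl cp.
- by rewrite /a0 !bformE -/ga -/al; ring.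
- by rewrite bformZl -/ga mulVf.
- by rewrite /a0 !bformE bya byc; ring.
- by rewrite bformZr byc mulr0.
- by rewrite /a0 !bformE halt bac; ring.
rewrite uN /a0 -scaleNr wedgeDl !wedgeZl !wedgeZr wedgexx !scaler0 addr0.
by rewrite scalerA divff // scale1r.
Qed.

Hypothesis S'wedge : wedge_spanned pi' S'.

(** The linear form [u |-> b (y *m u) f] vanishes on lifts of the wedges of [S'], which span it, and
    on elements with zero reduction, hence on the whole annihilator of [x]. *)
Lemma annmx_kills_y u : (mxvec u <= annmx S x)%MS -> y *m u = 0.
Proof.
move=> Au; pose A0 := (annmx S x :&: kermx (lin_mul_row y *m (B *m f^T)))%MS.
have A0P u' :
    (mxvec u' <= A0)%MS = (mxvec u' <= annmx S x)%MS && (b (y *m u') f == 0).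
  rewrite sub_capmx sub_kermx mulmxA mul_vec_lin_row; congr (_ && _).
  rewrite /bform mulmxA; apply/eqP/eqP => [->|wf0]; first by rewrite mxE.
  by rewrite [LHS]mx11_scalar wf0 raddf0.
have subT : (S' <= A0 *m compressmx pi')%MS.
  apply: S'wedge => a c ap cp /mem_compressmx[w Aw wN].
  apply/mem_compressmx; exists w => //; rewrite A0P Aw /=; apply/eqP.
  exact: (annmx_wedge ap cp Aw (esym wN)).
have /mem_compressmx[w] := submx_trans (mem_reduction Au) subT.
rewrite A0P => /andP[Aw /eqP yw] uw.
have yuw : b (y *m (u - w)) f = 0.
  apply: annmx_orbit; first exact: mem_mxB.
  by move=> d _ _; rewrite (mulmxBr pi') (mulmxBl (pi' *m u)) uw subrr mulmx0.
move: yuw; rewrite mulmxBr bformDl bformNl yw subr0 => yu.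
by rewrite (annmx_mul Au (D_subproj yD)) yu scale0r addr0 yS' // mem_reduction.
Qed.

(** Suppose [w] is orthogonal to [x] and [y] but not to [y v]. For a lift [u] of
    [wedge y (w *m pi')], [\tr (u *m v) = 0] contradicts this; the extra term [wedge x (f *m u)]
    contributes nothing because [y u = 0]. *)
Lemma plane_stable : (y *m v <= x + y)%MS.
Proof.
have [sp pp] := proj_pi; have [sp' pp'] := proj'.
have [sv nv pv vp] := nS Sv.
apply/negPn/negP => /(bform_separate hnd)[w [w_orth bwyv]].
have bwx : b w x = 0 by rewrite w_orth // addsmxSl.
have bwy : b w y = 0 by rewrite w_orth // addsmxSr.
pose z := w *m pi'; have zp : z *m pi' = z by rewrite /z -mulmxA pp'.
have byz : b y z = 0 by apply: bform_eq0C => //; rewrite /z sp' (D_subproj yD).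
have [u Au uN] := wedge_y zp byz.
have [Su xu su nu [pu up]] := mem_annmx_nil nS Au.
have byfu : b y (f *m u) = 0 by rewrite -su annmx_kills_y // bform0l.
have byvz : b (y *m v) z = 0.
  have /eqP := nil_space_trace hchar nS Su Sv.
  rewrite (annihilator_decomp hchar halt f su pu up xu) -/pi' uN mulmxDl raddfD /=.
  rewrite !mxtrace_wedge // -!sv -def_y byfu mulr0 addr0 mulf_eq0 (negPf hchar).
  by move/eqP.
have : b (w *m pi) (y *m v) = 1 by rewrite sp -mulmxA vp.
have -> : w *m pi = z - b f w *: x.
  by rewrite /z mul_subproj (bform_eq0C halt bwx) scale0r subr0 addrK.
rewrite !bformE (bform_eq0C halt byvz) -sv -def_y halt mulr0 subr0 => /esym/eqP.
by rewrite oner_eq0.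
Qed.

(** The last nonzero [x *m v ^+ j] lies in the plane of [x] and [y], so whatever kills [x] kills it;
    [v] kills it but not [x]. Its annihilator in [S] is therefore strictly larger. *)
Lemma rank_evalmx_descent : exists z : 'rV[F]_n,
  [/\ z != 0, z *m pi = z & (\rank (evalmx S z) < \rank (evalmx S x))%N].
Proof.
have [[k' vk0] pv vp] : [/\ nilpotent_mx v, pi *m v = v & v *m pi = v].
  by have [] := nS Sv.
have orb j : (x *m v ^+ j <= x + y)%MS.
  elim: j => [|j IHj]; first by rewrite expr0 mulmx1 addsmxSl.
  rewrite -mulmx_exprSr mulmxA; apply: submx_trans (submxMr v IHj) _.
  by rewrite addsmxMr addsmx_sub -def_y addsmxSr plane_stable.
have ex0 : exists j, x *m v ^+ j == 0 by exists k'; rewrite vk0 mulmx0.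
case: (ex_minnP ex0) => -[|j] /eqP xj0 min_j.
  by case/eqP: x0; rewrite -xj0 expr0 mulmx1.
have zk : x *m v ^+ j != 0 by apply/negP => /min_j; rewrite ltnn.
have ypi : y *m pi = y by rewrite def_y -mulmxA vp.
have kill u : (mxvec u <= annmx S x)%MS -> x *m v ^+ j *m u = 0.
  move=> Au; have /sub_addsmxP[[E1 E2] /= ->] := orb j.
  move: (Au); rewrite mem_annmx => /andP[_ /eqP xu].
  by rewrite mulmxDl -!mulmxA xu annmx_kills_y // !mulmx0 addr0.
exists (x *m v ^+ j); split=> //.
  have /sub_addsmxP[[E1 E2] /= ->] := orb j.
  by rewrite mulmxDl -!mulmxA xpi ypi.
have lt_ann : (annmx S x < annmx S (x *m v ^+ j))%MS.
  rewrite ltmxE; apply/andP; split.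
    apply/rV_subP => s; rewrite -[s]vec_mxK => As; rewrite mem_annmx kill // eqxx.
    by move: As; rewrite mem_annmx => /andP[->].
  apply/negP => sub_ann; have : (mxvec v <= annmx S x)%MS.
    by apply: submx_trans sub_ann; rewrite mem_annmx Sv -mulmxA mulmx_exprSr xj0 eqxx.
  by rewrite mem_annmx -def_y (negPf y0) andbF.
have := rank_ltmx lt_ann.
by have := rank_evalmx S x; have := rank_evalmx S (x *m v ^+ j); lia.
Qed.

End CommonVector.

End Descent.

(** Descent on the rank of [x S]: while it is nonzero, the induction hypothesis on the reduction
    supplies [y] in [x S], hence a vector with a smaller evaluation space. *)
Lemma extremal_common_kernel mu k pi (S : 'M[F]_(k, n * n)) :
  (forall k' pi' (S' : 'M[F]_(k', n * n)), extremal mu pi' S' ->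
     common_kernel_property pi' S' /\ wedge_spanned pi' S') ->
  extremal mu.+1 pi S ->
  exists x, [/\ x != 0, x *m pi = x &
    forall u, (mxvec u <= S)%MS -> x *m u = 0].
Proof.
move=> IH extS; have [proj_pi rk_pi nS rkS] := extS.
suff descent r x : x != 0 -> x *m pi = x -> (\rank (evalmx S x) <= r)%N ->
    exists x, [/\ x != 0, x *m pi = x & forall u, (mxvec u <= S)%MS -> x *m u = 0].
  have /rowV0Pn[x xp x0] : pi != 0 by rewrite -mxrank_eq0 rk_pi.
  apply: (descent (\rank (evalmx S x)) x) => //.
  by apply: sub_projector xp; case: proj_pi.
elim: r x => [|r IHr] x x0 xpi le_r; have [D0|D0] := eqVneq (evalmx S x) 0.
- exists x; split=> // u Su; have /submxP[E ->] : (x *m u <= evalmx S x)%MS.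
    by apply/evalmxP; exists u.
  by rewrite D0 mulmx0.
- by move: le_r; rewrite leqn0 mxrank_eq0 (negPf D0).
- exists x; split=> // u Su; have /submxP[E ->] : (x *m u <= evalmx S x)%MS.
    by apply/evalmxP; exists u.
  by rewrite D0 mulmx0.
have [f [fpi bxf forth]] := exists_dual halt hnd proj_pi nS x0 xpi.
have [ext' _] := extremal_reduction extS xpi fpi bxf forth.
have [ker' span'] := IH _ _ _ ext'.
have D_le : (evalmx S x <= pi - wedge x f)%MS.
  exact: (eval_sub_subproj hchar halt nS forth).
have [y [y0 yD yS']] := ker' _ _ D_le D0 (D_stable extS x0 xpi fpi bxf forth).
have /evalmxP[v Sv def_y] := yD.
have [z [z0 zpi lt_z]] :=
  rank_evalmx_descent extS x0 xpi fpi bxf forth Sv def_y y0 yS' span'.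
by apply: (IHr z) => //; rewrite -ltnS (leq_trans lt_z).
Qed.

End Extremal.

(** * The invariant flag *)

Section Structure.
Variables (F : fieldType) (n : nat) (B : 'M[F]_n).
Hypothesis hchar : (2%:R : F) != 0.
Hypothesis halt : alternating_form B.
Hypothesis hnd : nondegenerate_form B.

Local Notation b := (bform B).
Local Notation sa := (selfadjoint B).
Local Notation wedge := (wedge B).
Implicit Types (x y z w t a c e f g : 'rV[F]_n) (u v pi : 'M[F]_n).

Definition singular_flag_property mu k pi (S : 'M[F]_(k, n * n)) :=
  exists Fl : nat -> 'M[F]_n,
    [/\ partially_complete_flag mu Fl, totally_singular B (Fl mu),
        forall i, (i <= mu)%N -> (Fl i <= pi)%MS
      & forall u, (mxvec u <= S)%MS -> stabilizes mu Fl u].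

Section Step.
Variables (mu k : nat) (pi : 'M[F]_n) (S : 'M[F]_(k, n * n)) (x f : 'rV[F]_n).
Hypothesis extS : extremal B mu.+1 pi S.
Hypothesis x0 : x != 0.
Hypothesis xpi : x *m pi = x.
Hypothesis xS : forall u, (mxvec u <= S)%MS -> x *m u = 0.
Hypothesis fpi : f *m pi = f.
Hypothesis bxf : b x f = 1.

Let pi' := pi - wedge x f.
Let S' := reduction B pi x f S.

Let forth : forall u, (mxvec u <= S)%MS -> b f (x *m u) = 0.
Proof. by move=> u Su; rewrite xS // bform0r. Qed.
Let proj_pi : projector B pi. Proof. by case: extS. Qed.
Let nS : nil_space B pi S. Proof. by case: extS. Qed.
Let proj' : projector B pi'. Proof. exact: (projector_subproj halt). Qed.

Let annmxS u : (mxvec u <= S)%MS -> (mxvec u <= annmx S x)%MS.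
Proof. by move=> Su; rewrite mem_annmx Su xS // eqxx. Qed.

(** Unless [x] lies in [D], the part [D'] of [D] orthogonal to [x] embeds in the image of [pi'] and
    contains [D S]. A vector of that embedded space killed by [S'] lifts to one of [D'] killed by
    [S], by injectivity. *)
Lemma common_kernel_step :
  common_kernel_property pi' S' -> common_kernel_property pi S.
Proof.
move=> ker' m D Dpi D0 DS.
have [xD|xD] := boolP (x <= D)%MS; first by exists x.
have Dp t : (t <= D)%MS -> t *m pi = t.
  by move=> tD; apply: sub_projector (submx_trans tD Dpi); case: proj_pi.
have DSt t u : (t <= D)%MS -> (mxvec u <= S)%MS -> (t *m u <= D)%MS.
  by move=> tD Su; apply: submx_trans (submxMr _ tD) (DS _ Su).
pose D' := (D :&: kermx (B *m x^T))%MS.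
have D'P t : (t <= D')%MS = (t <= D)%MS && (b x t == 0).
  rewrite sub_capmx sub_kermx bform_antisym // oppr_eq0; congr (_ && _).
  rewrite /bform mulmxA; apply/eqP/eqP => [->|tx0]; first by rewrite mxE.
  by rewrite [LHS]mx11_scalar tx0 raddf0.
have D'S t u : (t <= D)%MS -> (mxvec u <= S)%MS -> (t *m u <= D')%MS.
  move=> tD Su; have [su _ _ _] := nS Su.
  by rewrite D'P DSt // -su xS // bform0l eqxx.
have D'p t : (t <= D')%MS -> t *m pi' = t + b f t *: x.
  rewrite D'P => /andP[tD /eqP bxt].
  by rewrite mul_subproj Dp // bxt scale0r subr0.
have D'inj t : (t <= D')%MS -> t *m pi' = 0 -> t = 0.
  move=> tD'; rewrite D'p // => /eqP; rewrite addr_eq0 => /eqP tE.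
  have [bft|bft] := eqVneq (b f t) 0; first by rewrite tE bft scale0r oppr0.
  case/negP: xD; have -> : x = - (b f t)^-1 *: t.
    by rewrite {2}tE scaleNr scalerN opprK scalerA mulVf // scale1r.
  by apply: scalemx_sub; move: tD'; rewrite D'P => /andP[].
have [D'0|D'0] := eqVneq D' 0.
  have /rowV0Pn[y yD y0] := D0; exists y; split=> // u Su; apply/eqP.
  by rewrite -submx0 -D'0 D'S.
have [|||y [y0 /submxP[E yE] yS']] := ker' _ (D' *m pi').
- exact: submxMl.
- apply: contraNneq D'0 => D'pi0; apply/eqP/row_matrixP => i.
  by rewrite row0; apply: D'inj; rewrite ?row_sub // -row_mul D'pi0 row0.
- move=> u' /mem_compressmx[u Au ->]; apply/rV_subP => t /submxP[E ->].
  have [Su xu su _ [pu up]] := mem_annmx_nil nS Au; have [_ pp'] := proj'.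
  rewrite !mulmxA; set d := E *m D'; have dD' : (d <= D')%MS by rewrite submxMl.
  rewrite -[d *m pi' *m pi']mulmxA pp' D'p // mulmxDl -scalemxAl xu scaler0 addr0.
  by apply: submxMr; apply: D'S => //; move: dD'; rewrite D'P => /andP[].
rewrite mulmxA in yE; set t := E *m D' in yE.
have tD' : (t <= D')%MS by rewrite submxMl.
have tD : (t <= D)%MS by move: tD'; rewrite D'P => /andP[].
exists t; split=> //; first by apply: contraNneq y0 => t0; rewrite yE t0 mul0mx.
move=> u Su; apply: D'inj; first exact: D'S.
have xu := xS Su; have [_ pp'] := proj'.
rewrite -[RHS](yS' (pi' *m u *m pi')) ?yE; last first.
  by apply/mem_compressmx; exists u => //; apply: annmxS.
rewrite !mulmxA -[t *m pi' *m pi']mulmxA pp' (D'p t tD') mulmxDl -scalemxAl xu.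
by rewrite scaler0 addr0.
Qed.

(** As [x S = 0], extremality puts into [S] all [wedge x w] with [w] in the image of [pi] and
    orthogonal to [x]. Both summands of [annihilator_decomp] are thus in [S], and so is [S']. *)
Lemma wedge_spanned_step : wedge_spanned B pi' S' -> wedge_spanned B pi S.
Proof.
move=> span' m T Twedge.
have Sxw w : w *m pi = w -> b x w = 0 -> (mxvec (wedge x w) <= S)%MS.
  move=> wpi bxw; apply: (extremal_wedge hchar halt hnd extS) => // u Su.
  by rewrite xS // bform0r.
have decomp u : (mxvec u <= S)%MS -> u = pi' *m u *m pi' + wedge x (f *m u) /\
    (mxvec (wedge x (f *m u)) <= S)%MS /\ f *m u *m pi = f *m u.
  move=> Su; have [su nu pu up] := nS Su; have xu := xS Su; split.
    exact: (annihilator_decomp hchar halt f su pu up xu).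
  have fup : f *m u *m pi = f *m u by rewrite -mulmxA up.
  by split=> //; apply: Sxw => //; rewrite -su xu bform0l.
have S'T : (S' <= T)%MS.
  apply: span' => a c ap cp /mem_compressmx[u Au wE].
  have [_ _ ap_] := subproj_orth halt proj_pi xpi fpi bxf ap.
  have [_ _ cp_] := subproj_orth halt proj_pi xpi fpi bxf cp.
  apply: Twedge => //; have [Su _ _ _ _] := mem_annmx_nil nS Au.
  have [uE [Sx _]] := decomp u Su.
  by rewrite wE -[_ *m pi'](addrK (wedge x (f *m u))) -uE mem_mxB.
apply/rV_subP => s; rewrite -[s]vec_mxK; set u := vec_mx s => Su.
have [uE [Sx fup]] := decomp u Su; rewrite {1}uE.
apply: mem_mxD; last exact: Twedge.
apply: submx_trans S'T; apply/mem_compressmx.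
by exists u => //; apply: annmxS.
Qed.

Lemma singular_flag_step :
  singular_flag_property mu pi' S' -> singular_flag_property mu.+1 pi S.
Proof.
case=> Fl' [[Fl'S Fl'r] Fl'sing Fl'pi Fl'stab].
have Fl'p i t : (i <= mu)%N -> (t <= Fl' i)%MS -> t *m pi' = t.
  move=> le_i tF; apply: sub_projector; first by case: proj'.
  exact: submx_trans tF (Fl'pi _ le_i).
(* The flag of the reduction is shifted by one and [x] is added to each of its terms. *)
exists (fun i => if i is j.+1 then (x + Fl' j)%MS else 0); split.
- split=> [[|i] lt_i|[|i] le_i]; first exact: sub0mx.
  + by apply: addsmxS => //; apply: Fl'S.
  + by rewrite mxrank0.
  rewrite mxrank_disjoint_sum ?rank_rV ?x0 ?Fl'r //.
  apply/eqP/rowV0P => t; rewrite sub_capmx => /andP[/sub_rVP[k1 ->] /Fl'p].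
  rewrite -scalemxAl (subproj_x halt xpi bxf) scaler0 => /(_ le_i) <-.
  by [].
- move=> s t /sub_addsmxP[[E1 E2] /= ->] /sub_addsmxP[[E3 E4] /= ->].
  have orth d : (d <= Fl' mu)%MS -> b x d = 0.
    by move=> /(Fl'p _ _ (leqnn mu)) /(subproj_orth halt proj_pi xpi fpi bxf)[].
  rewrite [E1]mx11_scalar [E3]mx11_scalar !mul_scalar_mx !bformE halt.
  rewrite [b _ x]bform_antisym // !orth ?submxMl // Fl'sing ?submxMl //.
  by rewrite !(oppr0, mulr0, addr0).
- case=> [|i] le_i; first exact: sub0mx.
  rewrite addsmx_sub -{1}xpi submxMl /= (submx_trans (Fl'pi i le_i)) //.
  by rewrite -[pi'](subproj_pi proj_pi xpi fpi) submxMl.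
move=> u Su [|i] le_i; first by rewrite mul0mx.
rewrite addsmxMr addsmx_sub xS // sub0mx /=; apply/rV_subP => t /submxP[E ->].
rewrite mulmxA; set d := E *m Fl' i; have dF : (d <= Fl' i)%MS by rewrite submxMl.
rewrite (annmx_mul hchar halt extS xpi fpi bxf (annmxS Su) (Fl'p _ _ le_i dF)).
apply: addmx_sub; last by rewrite scalemx_sub // addsmxSl.
apply: submx_trans (addsmxSr _ _); apply: submx_trans (submxMr _ dF) _.
by apply: Fl'stab => //; apply/mem_compressmx; exists u => //; apply: annmxS.
Qed.

End Step.

(** The three properties share one induction: the first two at [mu] produce the killed vector at
    [mu.+1], along which all three are lifted. *)
Lemma extremal_structure mu k pi (S : 'M[F]_(k, n * n)) :
  extremal B mu pi S ->
  [/\ common_kernel_property pi S, wedge_spanned B pi S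
    & singular_flag_property mu pi S].
Proof.
elim: mu k pi S => [|mu IHmu] k pi S extS.
  have [_ rk0 nS _] := extS; split.
  - move=> m D Dpi D0; have := mxrankS Dpi.
    by rewrite rk0 leqn0 mxrank_eq0 (negPf D0).
  - by move=> m T _; rewrite (rank0_nil_space rk0 nS) sub0mx.
  exists (fun _ => 0); split.
  - by split=> // i; rewrite leqn0 mxrank0 => /eqP.
  - by move=> s t; rewrite submx0 => /eqP -> _; rewrite bform0l.
  - by move=> i _; rewrite sub0mx.
  by move=> u _ i _; rewrite mul0mx.
have IH k' pi' (S' : 'M[F]_(k', n * n)) : extremal B mu pi' S' ->
    common_kernel_property pi' S' /\ wedge_spanned B pi' S'.
  by case/IHmu.
have [x [x0 xpi xS]] := extremal_common_kernel hchar halt hnd IH extS.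
have [proj_pi _ nS _] := extS.
have [f [fpi bxf forth]] := exists_dual halt hnd proj_pi nS x0 xpi.
have [/IHmu[ker' span' flag'] _] := extremal_reduction hchar halt hnd extS xpi fpi bxf forth.
split.
- exact: (common_kernel_step extS x0 xpi xS fpi bxf ker').
- exact: (wedge_spanned_step extS x0 xpi xS fpi bxf span').
exact: (singular_flag_step extS x0 xpi xS fpi bxf flag').
Qed.

End Structure.

(** * Lagrangian subspaces, and nilpotency as strictness on a flag *)

Section Lagrangian.
Variables (F : fieldType) (n : nat) (B : 'M[F]_n).
Hypothesis halt : alternating_form B.
Hypothesis hnd : nondegenerate_form B.

Local Notation b := (bform B).

Lemma sub_orthP m (X : 'M[F]_(m, n)) (t : 'rV[F]_n) :
  reflect (forall z : 'rV_n, (z <= X)%MS -> b t z = 0)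
    (t <= kermx (B *m X^T))%MS.
Proof.
apply: (iffP sub_kermxP) => [tX z /submxP[E ->]|tX].
  by rewrite /bform trmx_mul !mulmxA -(mulmxA t) tX mul0mx mxE.
apply/rowP => j; rewrite [RHS]mxE -(tX (row j X)) ?row_sub //.
by rewrite /bform mulmxA tr_row colE mulmxA -colE [RHS]mxE.
Qed.

Lemma rank_orth m (X : 'M[F]_(m, n)) : \rank (kermx (B *m X^T)) = (n - \rank X)%N.
Proof.
by rewrite mxrank_ker eqmxMfull ?row_full_unit ?form_unitmx // mxrank_tr.
Qed.

Lemma totally_singular_sub m (X : 'M[F]_(m, n)) :
  totally_singular B X -> (X <= kermx (B *m X^T))%MS.
Proof. by move=> Xs; apply/rV_subP => t tX; apply/sub_orthP => z; apply: Xs. Qed.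

(** A vector orthogonal to a maximal totally singular [X] but outside it could be added to it, being
    isotropic by alternation; so [X] is its own orthogonal. *)
Lemma witt_index_half nu : witt_index B nu -> n = nu.*2.
Proof.
case=> -[X [Xs rkX]] maxX; have := mxrankS (totally_singular_sub Xs).
rewrite rank_orth rkX => le_nu; have le_n := rank_leq_col X.
apply/eqP; rewrite -addnn eqn_leq andbC; apply/andP; split; first by lia.
rewrite leqNgt; apply/negP => lt_nu.
have : ~~ (kermx (B *m X^T) <= X)%MS.
  by apply/negP => /mxrankS; rewrite rank_orth rkX; lia.
case/row_subPn => i; set t := row i _ => tX.
have /sub_orthP t_orth : (t <= kermx (B *m X^T))%MS by exact: row_sub.
have : (X < X + t)%MS by rewrite ltmxE addsmxSl addsmx_sub submx_refl.
move/rank_ltmx; rewrite rkX ltnNge maxX //.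
move=> r s /sub_addsmxP[[E1 E2] /= ->] /sub_addsmxP[[E3 E4] /= ->].
rewrite [E2]mx11_scalar [E4]mx11_scalar !mul_scalar_mx !bformE halt.
rewrite Xs ?submxMl // [b _ t]bform_antisym // !t_orth ?submxMl //.
by rewrite !(oppr0, mulr0, addr0).
Qed.

Lemma lagrangian_orth (X : 'M[F]_n) t : totally_singular B X -> n = (\rank X).*2 ->
  (forall z : 'rV_n, (z <= X)%MS -> b t z = 0) -> (t <= X)%MS.
Proof.
move=> Xs nX /sub_orthP; move/submx_trans; apply.
rewrite -(mxrank_leqif_sup (totally_singular_sub Xs)) rank_orth.
by apply/eqP; lia.
Qed.

(** On the line [Fl i.+1 / Fl i], [u] acts by a scalar, which nilpotency forces to be zero. *)
Lemma nilpotent_flag_strict mu (Fl : nat -> 'M[F]_n) u i :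
  partially_complete_flag mu Fl -> nilpotent_mx u -> stabilizes mu Fl u ->
  (i < mu)%N -> (Fl i.+1 *m u <= Fl i)%MS.
Proof.
move=> [FlS Flr] [k uk0] stab lt_i.
have : ~~ (Fl i.+1 <= Fl i)%MS.
  by apply/negP => /mxrankS; rewrite !Flr // ?(ltnW lt_i) // ltnn.
case/row_subPn => j; set t := row j _ => tFl.
have tFl1 : (t <= Fl i.+1)%MS by exact: row_sub.
have FlE : (Fl i.+1 <= Fl i + t)%MS.
  have sub : (Fl i + t <= Fl i.+1)%MS by rewrite addsmx_sub FlS.
  rewrite -(mxrank_leqif_sup sub) Flr // eqn_leq -{1}[i.+1](Flr i.+1) // mxrankS //=.
  have : (Fl i < Fl i + t)%MS by rewrite ltmxE addsmxSl addsmx_sub submx_refl.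
  by move/rank_ltmx; rewrite Flr // ltnW.
have Fli : (Fl i *m u <= Fl i)%MS by apply: stab; apply: ltnW.
have /sub_addsmxP[[E1 E2] /= tuE] : (t *m u <= Fl i + t)%MS.
  apply: submx_trans FlE; apply: submx_trans (submxMr u tFl1) _.
  exact: stab.
have tu_scal : exists2 d : 'rV_n, (d <= Fl i)%MS & t *m u = d + E2 0 0 *: t.
  exists (E1 *m Fl i); first exact: submxMl.
  by rewrite tuE {1}[E2]mx11_scalar mul_scalar_mx.
case: tu_scal => d dFl tuE'; set al := E2 0 0 in tuE'.
have al0 : al = 0.
  have tuk m : exists2 d : 'rV_n, (d <= Fl i)%MS & t *m u ^+ m = d + al ^+ m *: t.
    elim: m => [|m [d' d'Fl IHm]].
      by exists 0; rewrite ?sub0mx // !expr0 mulmx1 scale1r add0r.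
    exists (d' *m u + al ^+ m *: d).
      by rewrite addmx_sub ?scalemx_sub // (submx_trans (submxMr u d'Fl)).
    rewrite -mulmx_exprSr mulmxA IHm mulmxDl -scalemxAl tuE' scalerDr scalerA.
    by rewrite -exprSr addrA.
  have [d' d'Fl] := tuk k; rewrite uk0 mulmx0 => /esym/eqP; rewrite addr_eq0 => /eqP d'E.
  apply/eqP; apply: contraNT tFl => al0.
  have -> : t = - (al ^- k *: d').
    by rewrite d'E scalerN opprK scalerA mulVf ?expf_neq0 // scale1r.
  by rewrite eqmx_opp scalemx_sub.
apply: submx_trans (submxMr u FlE) _.
by rewrite addsmxMr addsmx_sub Fli tuE' al0 scale0r addr0.
Qed.

(** [u ^+ nu] kills [Fl nu]; by selfadjointness its image is orthogonal to [Fl nu], hence inside it,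
    so the power [nu + nu] vanishes. *)
Lemma strict_flag_nilpotent nu (Fl : nat -> 'M[F]_n) u :
  partially_complete_flag nu Fl -> totally_singular B (Fl nu) -> n = nu.*2 ->
  selfadjoint B u -> (forall i, (i < nu)%N -> (Fl i.+1 *m u <= Fl i)%MS) ->
  nilpotent_mx u.
Proof.
move=> [FlS Flr] Fls nnu su strict.
have Flu i : (i <= nu)%N -> (Fl nu *m u ^+ i <= Fl (nu - i)%N)%MS.
  elim: i => [|i IHi] le_i; first by rewrite expr0 mulmx1 subn0.
  rewrite -mulmx_exprSr mulmxA; apply: submx_trans (submxMr u (IHi (ltnW le_i))) _.
  have -> : (nu - i = (nu - i.+1).+1)%N by lia.
  by apply: strict; lia.
have Fl0 : Fl nu *m u ^+ nu = 0.
  apply/eqP; rewrite -mxrank_eq0 -leqn0; apply: leq_trans (mxrankS (Flu nu _)) _ => //.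
  by rewrite subnn Flr.
exists (nu + nu)%N; apply: mulmx_ext => t; rewrite mulmx0 exprD -mulmxE mulmxA.
have /submxP[E ->] : (t *m u ^+ nu <= Fl nu)%MS.
  apply: lagrangian_orth; rewrite ?Flr // => z /submxP[E ->].
  by rewrite (selfadjoint_exp nu su) -mulmxA Fl0 mulmx0 bform0r.
by rewrite -mulmxA Fl0 mulmx0.
Qed.

End Lagrangian.

(* The subspace \mathcal{V} of End(V) is the row space of S : 'M_(k, n*n),
   a matrix u belonging to it iff (mxvec u <= S)%MS; its dimension is \rank S. *)
Theorem mainTheorem3 (F : fieldType) (n : nat) (B : 'M[F]_n) (nu k : nat)
  (S : 'M[F]_(k, n * n))
  (hchar : (2%:R : F) != 0)
  (halt : alternating_form B) (hnd : nondegenerate_form B)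
  (hwitt : witt_index B nu)
  (hsub : forall u : 'M[F]_n, (mxvec u <= S)%MS -> b_alternating B u)
  (hnil : forall u : 'M[F]_n, (mxvec u <= S)%MS -> nilpotent_mx u)
  (hdim : \rank S = (nu * (n - nu - 1))%N) :
  exists Fl : nat -> 'M[F]_n,
    maximal_singular_flag B nu Fl /\
    (forall u : 'M[F]_n, (mxvec u <= S)%MS <-> in_WA B nu Fl u).
Proof.
have n2 := witt_index_half halt hnd hwitt.
have proj1 : projector B 1%:M by split=> [x y|]; rewrite ?mulmx1.
have rk1 : \rank (1%:M : 'M[F]_n) = nu.*2 by rewrite mxrank1.
have rkS : \rank S = (nu * nu.-1)%N by rewrite hdim; congr (_ * _)%N; lia.
have nS : nil_space B 1%:M S.
  move=> u Su; split; rewrite ?mul1mx ?mulmx1 //; last exact: hnil.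
  by apply: alternating_selfadjoint => //; apply: hsub.
have [_ _ [Fl [Flag Fls _ Flstab]]] :=
  extremal_structure hchar halt hnd (And4 proj1 rk1 nS rkS).
exists Fl; split=> [|u]; first by [].
split=> [Su|[nu_ [alt_u stab_u]]].
  by split; [exact: hnil | split; [exact: hsub | exact: Flstab]].
have su := alternating_selfadjoint halt alt_u.
have strict v : nilpotent_mx v -> stabilizes nu Fl v ->
    forall i, (i < nu)%N -> (Fl i.+1 *m v <= Fl i)%MS.
  by move=> nv stab_v i; apply: nilpotent_flag_strict Flag nv stab_v.
(* For the reverse inclusion [u] is adjoined to [S]. Strictness on the flag is a linear condition,
   so the sum is still a nilpotent space, and the dimension bound puts [u] in [S]. *)
have nSu : nil_space B 1%:M (S + mxvec u)%MS.
  move=> w /sub_addsmxP[[E1 E2] /= wE].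
  have [v Sv [a def_w]] : exists2 v, (mxvec v <= S)%MS & exists a, w = v + a *: u.
    exists (vec_mx (E1 *m S)); first by rewrite vec_mxK submxMl.
    exists (E2 0 0); apply: (can_inj mxvecK).
    by rewrite wE linearD linearZ /= vec_mxK {1}[E2]mx11_scalar mul_scalar_mx.
  have [sv nv _ _] := nS v Sv.
  have sw : selfadjoint B w.
    rewrite def_w; apply: selfadjointD => // x y.
    by rewrite -!scalemxAr bformZl bformZr su.
  split; rewrite ?mul1mx ?mulmx1 //.
  apply: (strict_flag_nilpotent hnd Flag Fls n2 sw) => i lt_i.
  rewrite def_w mulmxDr -scalemxAr addmx_sub ?scalemx_sub ?strict //.
  exact: Flstab.
have := nil_space_rank_le hchar halt hnd proj1 rk1 nSu; rewrite -rkS => le_rk.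
have : (S + mxvec u <= S)%MS.
  by rewrite -(mxrank_leqif_sup (addsmxSl S (mxvec u))) eqn_leq le_rk mxrankS ?addsmxSl.
by rewrite addsmx_sub => /andP[].
Qed.
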